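(* Let $n\ge2$, $p\in[1,n)$ and $\tau\in[-1,1]$. For any invertible linear transform $T\in GL(n)$ of $\mathbb{R}^n$ and any compact set $K\subset\mathbb{R}^n$, $$C_{p,\tau}(TK)=|\det(T)|^{\frac{n-p}{n}}\,C_{p,\tau}(K).$$ In particular, $C_{p,\tau}(TK)=C_{p,\tau}(K)$ for any $T\in GL(n)$ with $|\det(T)|=1$. Moreover, $C_{p,\tau}$ is positively homogeneous of degree $n-p$, i.e. $C_{p,\tau}(\lambda K)=\lambda^{n-p}C_{p,\tau}(K)$ for all $\lambda>0$, where $\lambda K=\{\lambda x:\ x\in K\}$.
   Context: $du$ is the rotation-invariant probability measure on $S^{n-1}$. For $\tau\in[-1,1]$ let $\varphi_\tau(t)=\big(\tfrac{1+\tau}{2}\big)^{1/p}t_++\big(\tfrac{1-\tau}{2}\big)^{1/p}t_-$, with $t_+=\max\{t,0\}$, $t_-=\max\{-t,0\}$. For $f\in C_c^\infty(\mathbb{R}^n)$ let $$\mathcal{H}_{p,\tau}(f)=\Big(\int_{S^{n-1}}\Big(\int_{\mathbb{R}^n}[\varphi_\tau(u\cdot\nabla f(x))]^p\,dx\Big)^{-n/p}du\Big)^{-p/n}$$ (with conventions $1/0=\infty$, $1/\infty=0$, so that $\mathcal{H}_{p,\tau}(0)=0$). The general $p$-affine capacity of a compact set $K\subset\mathbb{R}^n$ is $$C_{p,\tau}(K)=\inf\{\mathcal{H}_{p,\tau}(f):\ f\in C_c^\infty(\mathbb{R}^n),\ f\ge1\text{ on }K\}.$$ *)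

(* Defs.v *)
From HB Require Import structures.
From mathcomp Require Import all_boot all_order all_algebra.
From mathcomp Require Import all_classical all_reals all_analysis.
Set Implicit Arguments.
Unset Strict Implicit.
Unset Printing Implicit Defensive.
Import Order.TTheory GRing.Theory Num.Theory.
Import numFieldNormedType.Exports.

Local Open Scope classical_set_scope.
Local Open Scope ring_scope.

(* R^n is the space of column vectors 'cV[R]_n, with the sigma-algebra
   generated by the coordinates, as the library does for n.-tuple T; over the
   reals this is the Borel sigma-algebra. *)
Definition measure_cV_display : measure_display -> measure_display.
Proof. exact. Qed.

Section measurable_cV.
Context {d} {T : sigmaRingType d} (n : nat).

Let coors : 'I_n -> 'cV[T]_n -> T := fun i x => x i ord0.

Let cV_set0 : g_sigma_preimage coors set0.
Proof. exact: sigma_algebra0. Qed.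

Let cV_setC A : g_sigma_preimage coors A -> g_sigma_preimage coors (~` A).
Proof. exact: sigma_algebraC. Qed.

Let cV_bigcup (F : _^nat) : (forall i, g_sigma_preimage coors (F i)) ->
  g_sigma_preimage coors (\bigcup_i (F i)).
Proof. exact: sigma_algebra_bigcup. Qed.

HB.instance Definition _ := @isMeasurable.Build (measure_cV_display d)
  'cV[T]_n (g_sigma_preimage coors) cV_set0 cV_setC cV_bigcup.

End measurable_cV.

Section measurable_cV_lemmas.
Context d1 d2 (T1 : measurableType d1) (T2 : measurableType d2).

Lemma measurable_coord_cV n (i : 'I_n) :
  measurable_fun [set: 'cV[T2]_n] (fun x : 'cV[T2]_n => x i ord0).
Proof.
move=> _ Y mY; rewrite setTI; apply: sub_sigma_algebra => /=.
rewrite -bigcup_seq/=; exists i => /=; first by rewrite mem_index_enum.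
by exists Y => //; rewrite setTI.
Qed.

Lemma measurable_fun_cV n (f : T1 -> 'cV[T2]_n) :
  (forall i, measurable_fun [set: T1] (fun x => f x i ord0)) ->
  measurable_fun [set: T1] f.
Proof.
move=> mf _ A mA; rewrite setTI.
suff : g_sigma_preimage (fun i => (fun x : 'cV[T2]_n => x i ord0) \o f)
    `<=` measurable.
  apply; rewrite g_sigma_preimage_comp; exists A => //.
  by rewrite setTI.
apply: smallest_sub; first exact: sigma_algebra_measurable.
rewrite -bigcup_seq; apply: bigcup_sub => i _ _ [B mB <-].
exact: mf.
Qed.

End measurable_cV_lemmas.

(* Lebesgue measure on R^n: the n-fold product of lebesgue_measure, transported
   along R x R^n -> R^(n+1). *)
Section lebesgue_cV.
Context {R : realType}.

Definition cons_cV n (x : measurableTypeR R * 'cV[R]_n) : 'cV[R]_n.+1 :=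
  col_mx (x.1 : R)%:M x.2.

Lemma measurable_cons_cV n : measurable_fun setT (@cons_cV n).
Proof.
apply: measurable_fun_cV => i.
have [j ->|j ->] := split_ordP (i : 'I_(1 + n)).
  rewrite (_ : (fun _ => _) = fst)//.
  apply/funext => x; rewrite ord1; apply: etrans (col_mxEu _ _ _ _) _.
  by rewrite mxE.
rewrite (_ : (fun _ => _) =
    (fun v : 'cV[R]_n => v j ord0) \o (@snd (measurableTypeR R) 'cV[R]_n)).
  by apply: measurableT_comp => //; exact: measurable_coord_cV.
by apply/funext => x; apply: etrans (col_mxEd _ _ _ _) _.
Qed.

Section extend.
Variables (n : nat) (mu : {sigma_finite_measure set 'cV[R]_n -> \bar R}).
Local Open Scope ereal_scope.

Definition extend_cV : set 'cV[R]_n.+1 -> \bar R :=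
  pushforward ((@lebesgue_measure R) \x mu) (@cons_cV n).

Let extend0 : extend_cV set0 = 0.
Proof. by rewrite /extend_cV /pushforward preimage_set0 measure0. Qed.

Let extend_ge0 A : 0 <= extend_cV A.
Proof. by rewrite /extend_cV /pushforward; exact: measure_ge0. Qed.

Let extend_sigma_additive : semi_sigma_additive extend_cV.
Proof.
move=> F mF tF mUF; rewrite /extend_cV /pushforward preimage_bigcup.
have mp A : measurable A -> measurable (@cons_cV n @^-1` A).
  by move=> mA; rewrite -[X in measurable X]setTI; exact: measurable_cons_cV.
apply: measure_semi_sigma_additive.
- by move=> k; exact: mp.
- apply/trivIsetP => /= i j _ _ ij; rewrite -preimage_setI.
  by move/trivIsetP : tF => /(_ _ _ _ _ ij) ->//; rewrite preimage_set0.
- by rewrite -preimage_bigcup; exact: mp.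
Qed.

HB.instance Definition _ :=
  isMeasure.Build _ _ _ extend_cV extend0 extend_ge0 extend_sigma_additive.

Let uncons (v : 'cV[R]_n.+1) : measurableTypeR R * 'cV[R]_n :=
  (v ord0 ord0, dsubmx (v : 'cV[R]_(1 + n))).

Let unconsK x : uncons (cons_cV x) = x.
Proof.
case: x => a v; rewrite /uncons /cons_cV /=; congr pair; last exact: col_mxKd.
have e : ord0 = lshift n ord0 :> 'I_(1 + n) by exact: val_inj.
by apply: etrans (congr1 (fun i => col_mx a%:M v i ord0) e) _; rewrite col_mxEu mxE.
Qed.

Let measurable_uncons : measurable_fun setT uncons.
Proof.
apply/measurable_fun_pairP; split.
  exact: (measurable_coord_cV (T2 := R)).
apply: measurable_fun_cV => i /=.
rewrite (_ : (fun _ => _) = fun v : 'cV[R]_n.+1 => v (rshift 1 i) ord0).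
  exact: measurable_coord_cV.
by apply/funext => v; rewrite /uncons /= mxE.
Qed.

Let extend_sigma_finite : sigma_finite setT extend_cV.
Proof.
have /sigma_finiteP[F [TF ndF Foo]] := sigma_finiteT (@lebesgue_measure R).
have /sigma_finiteP[G [TG ndG Goo]] := sigma_finiteT mu.
exists (fun k => uncons @^-1` (F k `*` G k)).
  rewrite -preimage_bigcup; apply/esym; rewrite -subTset => v _ /=.
  have [k _ Fk] : (\bigcup_k F k) (uncons v).1 by rewrite -TF.
  have [l _ Gl] : (\bigcup_k G k) (uncons v).2 by rewrite -TG.
  exists (maxn k l) => //; split.
    by move: Fk; exact/subsetPset/ndF/leq_maxl.
  by move: Gl; exact/subsetPset/ndG/leq_maxr.
move=> k; have [mF Fk] := Foo k; have [mG Gk] := Goo k.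
have mFG : measurable (F k `*` G k) by exact: measurableX.
split; first by rewrite -[X in measurable X]setTI; exact: measurable_uncons.
rewrite /extend_cV /pushforward -comp_preimage.
rewrite (_ : uncons \o _ = id); last by apply/funext => x; exact: unconsK.
by rewrite preimage_id product_measure1E// lte_mul_pinfty// ge0_fin_numE.
Qed.

HB.instance Definition _ :=
  Measure_isSigmaFinite.Build _ _ _ extend_cV extend_sigma_finite.

End extend.

Fixpoint lebesgue_cV n : {sigma_finite_measure set 'cV[R]_n -> \bar R} :=
  match n with
  | 0 => dirac (0 : 'cV[R]_0)
  | m.+1 => extend_cV (lebesgue_cV m)
  end.

Lemma lebesgue_cV_box n (A : 'I_n -> set R) : (forall i, measurable (A i)) ->
  lebesgue_cV n [set x : 'cV[R]_n | forall i, A i (x i ord0)] =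
  (\prod_(i < n) lebesgue_measure (A i))%E.
Proof.
elim: n A => [|n IH] A mA.
  rewrite big_ord0 /= (_ : mkset _ = setT) ?diracT//.
  by apply/seteqP; split=> // x _ [].
rewrite big_ord_recl -IH//= /extend_cV /pushforward.
rewrite (_ : _ @^-1` _ = A ord0 `*` [set x : 'cV[R]_n | forall i, A (lift ord0 i) (x i ord0)]).
  rewrite product_measure1E//.
    exact: mA.
  rewrite (_ : mkset _ = \bigcap_(i in setT) ((fun x : 'cV[R]_n => x i ord0) @^-1` A (lift ord0 i))).
    apply: fin_bigcap_measurable => // i _; rewrite -[X in measurable X]setTI.
    by apply: measurable_coord_cV => //; exact: mA.
  by apply/seteqP; split=> x /= h i; [move=> _|]; exact: h.
have e (x : R * 'cV[R]_n) i : cons_cV x (lift ord0 i) ord0 = x.2 i ord0.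
  have -> : lift ord0 i = rshift 1 i by exact: val_inj.
  exact: col_mxEd.
have e0 (x : R * 'cV[R]_n) : cons_cV x ord0 ord0 = x.1.
  have h : ord0 = lshift n ord0 :> 'I_(1 + n) by exact: val_inj.
  by apply: etrans (congr1 (fun i => col_mx x.1%:M x.2 i ord0) h) _; rewrite col_mxEu mxE.
apply/seteqP; split=> x /=.
  by move=> h; split=> [|i]; [rewrite -e0|rewrite -e]; exact: h.
move=> [h0 h] i; case: (unliftP ord0 i) => [j ->|->]; first by rewrite e; exact: h.
by rewrite e0.
Qed.

End lebesgue_cV.

Section capacity.
Context {R : realType} {n : nat}.
Implicit Types (x u v : 'cV[R]_n) (f : 'cV[R]_n -> R) (p tau : R).
Implicit Type K : set 'cV[R]_n.

Definition dotcv u v : R := \sum_(i < n) u i ord0 * v i ord0.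

Definition partial (i : 'I_n) f : 'cV[R]_n -> R := 'D_(delta_mx i ord0) f.

Definition grad f x : 'cV[R]_n := \col_i partial i f x.

Definition smooth f :=
  forall s : seq 'I_n, let g := foldr partial f s in
    continuous g /\ forall i x, derivable g x (delta_mx i ord0).

Definition Ccoo : set ('cV[R]_n -> R) :=
  [set f | smooth f /\ compact (closure [set x | f x != 0])].

(* The norm of 'cV[R]_n in the library is the sup norm, so the unit sphere is
   spelled out with the Euclidean one. *)
Definition usphere : set 'cV[R]_n := [set u | dotcv u u = 1].

(* A measure on the sphere is represented by a measure on R^n carried by it.
   For n >= 2, SO(n) is transitive on the sphere and such a mu is unique. *)
Definition is_sphere_measure (mu : probability 'cV[R]_n R) :=
  mu usphere = 1%E /\
  forall Q : 'M[R]_n, Q^T *m Q = 1%:M -> \det Q = 1 ->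
    forall A : set 'cV[R]_n, measurable A ->
      mu [set Q *m x | x in A] = mu A.

Definition phi p tau (t : R) : R :=
  ((1 + tau) / 2) `^ p^-1 * Num.max t 0 +
  ((1 - tau) / 2) `^ p^-1 * Num.max (- t) 0.

(* Negative powers are inverses in \bar R, where 0^-1 = +oo and +oo^-1 = 0,
   because the library sets 0 `^ r = 0 for negative r. *)
Definition Haff (mu : probability 'cV[R]_n R) p tau f : \bar R :=
  (((\int[mu]_(u in usphere)
      ((\int[lebesgue_cV n]_x (phi p tau (dotcv u (grad f x)) `^ p)%:E)
         `^ (n%:R / p))^-1)
     `^ (p / n%:R))^-1)%E.

Definition affine_capacity (mu : probability 'cV[R]_n R) p tau K : \bar R :=
  ereal_inf [set Haff mu p tau f | f in
    [set f | Ccoo f /\ forall x, K x -> 1 <= f x]].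

End capacity.

(* Main.v *)
Require Import Defs.
From HB Require Import structures.
From mathcomp Require Import all_boot all_order all_algebra.
From mathcomp Require Import all_classical all_reals all_analysis.
From mathcomp Require Import measurable_realfun fingroup perm ring lra.
Import Order.TTheory GRing.Theory Num.Theory.
Import numFieldNormedType.Exports.
Local Open Scope classical_set_scope.
Local Open Scope ring_scope.
Set Implicit Arguments.
Unset Strict Implicit.
Unset Printing Implicit Defensive.

(* With E_f(u) the integral of phi(u . grad f)^p, the chain rule and the linear
   change of variables give E_(f o M)(u) = |det M|^-1 E_f(M u), and the function
   h = E_f^(-n/p) is homogeneous of degree -n.  Everything then rests on the identity
   |det M| * int_S h(M u) du = int_S h(u) du for such h.  Dilating by powers of b shows
   that all shells {1 <= rho < b}, rho a measurable gauge, have the same mass for h dx,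
   so the identity holds with S replaced by the annulus A = {1 <= |x| < b}.  On A the
   functions h(x) and h(x/|x|) differ by a factor between 1 and b^n, and the image of
   normalized Lebesgue measure on A under x -> x/|x| is rotation invariant, hence it is
   du.  This gives the identity up to a factor b^n, and b -> 1 concludes.
   Uniqueness of du follows from Fubini: two invariant probabilities give the same mass
   to all caps of a fixed radius, whence P1(E) <= P2(E') for E' a neighbourhood of E. *)

(** * Lebesgue measure on boxes *)

(** The measurability proof is an explicit argument, so that the pushforward comes as a bundled
    measure. *)
Definition push_measure d1 d2 (X : measurableType d1) (Y : measurableType d2)
    (R : realType) (m : {measure set X -> \bar R}) (f : X -> Y)
    (mf : measurable_fun setT f) : {measure set Y -> \bar R} :=
  measure_function_pushforward__canonical__measure_function_Measure m mf.

(** Both sides are measures in [A], so agreement on half-open intervals suffices; the sign of [a]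
    decides which end of the preimage is closed. *)
Lemma lebesgue_measure_affine (R : realType) (a c : R) (A : set (measurableTypeR R)) : a != 0 ->
  measurable A ->
  lebesgue_measure A = (`|a|%:E * lebesgue_measure ((fun x : R => a * x + c)%R @^-1` A))%E.
Proof.
move=> a0 mA.
pose f (x : measurableTypeR R) : measurableTypeR R := (a * x + c)%R.
have mf : measurable_fun setT f.
  by apply: measurable_funD => //; apply: measurable_funM.
pose m := mscale (NngNum (normr_ge0 a)) (push_measure (@lebesgue_measure R) mf).
suff e : forall X : set R, ocitv X -> lebesgue_measure X = m X.
  by rewrite (lebesgue_measure_unique e).
move=> X [] [x y] _ <- /=.
rewrite /m /mscale /= /pushforward.
case: (ltrP 0 a) => ha.
  have -> : f @^-1` `]x, y]%classic = `] (x - c) / a, (y - c) / a]%classic.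
    by apply/seteqP; split => t /=; rewrite !in_itv /= ltr_pdivrMr // ler_pdivlMr // /f ltrBlDr lerBrDr [t * a]mulrC.
  rewrite !lebesgue_measure_itv /= !lte_fin ltr_pM2r ?invr_gt0 // ltrD2r.
  case: ifPn => // _; last by rewrite mule0.
  rewrite gtr0_norm // -!EFinB -EFinM -mulrBl mulrC divfK //.
  by congr (_%:E); ring.
have {}ha : a < 0 by rewrite lt_neqAle a0.
have -> : f @^-1` `]x, y]%classic = `[ (y - c) / a, (x - c) / a[%classic.
  by apply/seteqP; split => t /=; rewrite !in_itv /= ltr_ndivlMr // ler_ndivrMr // /f ltrBlDr lerBrDr [t * a]mulrC andbC.
rewrite !lebesgue_measure_itv /= !lte_fin ltr_nM2r ?invr_lt0 // ltrD2r.
case: ifPn => // _; last by rewrite mule0.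
rewrite ltr0_norm // -!EFinB -EFinM -mulrBl mulNr mulrC divfK //.
by congr (_%:E); ring.
Qed.

Section open_boxes.
Context {R : realType} {n : nat}.
Implicit Types (a b x : 'cV[R]_n).

Definition obox a b : set 'cV[R]_n :=
  [set x | forall i, `]a i ord0, b i ord0[%classic (x i ord0)].

Lemma measurable_coord_preimage (A : 'I_n -> set (measurableTypeR R)) :
  (forall i, measurable (A i)) ->
  measurable [set x : 'cV[R]_n | forall i, A i (x i ord0)].
Proof.
move=> mA.
rewrite (_ : mkset _ = \bigcap_(i in setT) ((fun x : 'cV[R]_n => x i ord0) @^-1` A i)).
  apply: fin_bigcap_measurable => // i _; rewrite -[X in measurable X]setTI.
  by apply: measurable_coord_cV => //; exact: mA.
by apply/seteqP; split=> x /= h i; [move=> _|]; exact: h.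
Qed.

Lemma measurable_obox a b : measurable (obox a b).
Proof. exact: (measurable_coord_preimage (A := fun i => `]a i ord0, b i ord0[%classic)). Qed.

Lemma lebesgue_cV_obox a b : 
  lebesgue_cV n (obox a b) = (\prod_(i < n) lebesgue_measure `]a i ord0, b i ord0[%classic)%E.
Proof. by rewrite -(@lebesgue_cV_box R n (fun i => `]a i ord0, b i ord0[%classic)) // => i; exact: measurable_itv. Qed.

Definition oboxes : set (set 'cV[R]_n) := [set A | exists a b, A = obox a b].

Lemma lebesgue_cV_obox_lty a b : (lebesgue_cV n (obox a b) < +oo)%E.
Proof.
rewrite -ge0_fin_numE ?measure_ge0 // lebesgue_cV_obox.
elim/big_ind: _ => //; first exact: fin_numM.
by move=> i _; rewrite lebesgue_measure_itv; case: ifP.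
Qed.

Lemma oboxes_setI : setI_closed oboxes.
Proof.
move=> _ _ [a1 [b1 ->]] [a2 [b2 ->]].
exists (\col_i Num.max (a1 i ord0) (a2 i ord0)), (\col_i Num.min (b1 i ord0) (b2 i ord0)).
apply/seteqP; split=> x /=.
  move=> [h1 h2] i; have := h1 i; have := h2 i; rewrite /= !in_itv /= !mxE.
  by rewrite gt_max lt_min => /andP[-> ->] /andP[-> ->].
move=> h; split=> i; have := h i; rewrite /= !in_itv /= !mxE gt_max lt_min.
  by move=> /andP[/andP[-> _] /andP[-> _]].
by move=> /andP[/andP[_ ->] /andP[_ ->]].
Qed.

Lemma oboxes_cover : \bigcup_k obox (const_mx (- k%:R)) (const_mx k%:R) = setT.
Proof.
rewrite -subTset => x _.
have [N hN] : exists N : nat, forall i, `|x i ord0| < N%:R.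
  (* The sum dominates each of its terms, so one integer bounds all coordinates. *)
  exists (\sum_i (Num.truncn `|x i ord0|).+1)%N => i.
  apply: (lt_le_trans (truncnS_gt _)); rewrite ler_nat.
  by rewrite (bigD1 i) //= leq_addr.
exists N => // i; rewrite /= !mxE in_itv /=.
by rewrite -ltr_norml.
Qed.

(** It is enough that each coordinate is measurable for the sigma-algebra of the boxes: the
    half-space where coordinate [i] is below [c] is the union of the boxes from [lo k] to [hi k]. *)
Lemma oboxes_generate (A : set 'cV[R]_n) : measurable A -> <<s oboxes >> A.
Proof.
suff : g_sigma_preimage (fun (i : 'I_n) (x : 'cV[measurableTypeR R]_n) => x i ord0) `<=` <<s oboxes >>.
  by apply.
apply: smallest_sub; first exact: smallest_sigma_algebra.
rewrite -bigcup_seq; apply: bigcup_sub => i _ _ [B mB <-].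
pose T := g_sigma_algebraType oboxes.
have mf : measurable_fun setT (fun x : T => x i ord0 : measurableTypeR R).
  apply: (measurability _ (RGenInftyO.measurableE R)) => _ [_ [c ->] <-].
  pose lo k : 'cV[R]_n := const_mx (- k%:R).
  pose hi k : 'cV[R]_n := \col_j (if j == i then c else k%:R).
  rewrite (_ : _ `&` _ = \bigcup_k obox (lo k) (hi k)).
    by apply: bigcupT_measurable => k; apply: sub_sigma_algebra; exists (lo k), (hi k).
  apply/seteqP; split=> x /=.
    rewrite in_itv /= => -[_ xc].
    have [k _ kx] : (\bigcup_k obox (const_mx (- k%:R)) (const_mx k%:R)) x by rewrite oboxes_cover.
    exists k => // j; have := kx j; rewrite /= !in_itv /= !mxE => /andP[-> kj] /=.
    by case: eqP => [->|].
  move=> [k _ /(_ i)] /=; rewrite !in_itv /= !mxE eqxx => /andP[_ ->].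
  by split.
exact: mf.
Qed.

(** Open boxes form a generating family closed under intersection, and centred boxes of finite
    measure exhaust the space, so the uniqueness theorem for measures applies. *)
Lemma eq_measure_oboxes (m1 m2 : measure 'cV[R]_n R) :
  (forall a b, m1 (obox a b) = m2 (obox a b)) ->
  (forall a b, (m1 (obox a b) < +oo)%E) ->
  forall A, measurable A -> m1 A = m2 A.
Proof.
move=> e f A mA; apply: (@g_sigma_algebra_measure_unique _ _ _ oboxes _ 
   (fun k => obox (const_mx (- k%:R)) (const_mx k%:R))) => //.
- by move=> _ [a [b ->]]; exact: measurable_obox.
- by move=> k; eexists; eexists; reflexivity.
- exact: oboxes_cover.
- exact: oboxes_setI.
- by move=> _ [a [b ->]].
- exact: oboxes_generate.
Qed.

End open_boxes.

(** * Linear change of variables *)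

(** The product measure is defined by slicing along the first factor; its uniqueness allows slicing
    along the second. *)
Lemma product_measure_ysection d1 d2 (X : measurableType d1) (Y : measurableType d2)
    (R : realType) (m1 : {sigma_finite_measure set X -> \bar R})
    (m2 : {sigma_finite_measure set Y -> \bar R}) (D : set (X * Y)) : measurable D ->
  ((m1 \x m2) D = \int[m2]_y m1 (ysection D y))%E.
Proof.
move=> mD; rewrite (product_measure_unique (m' := (m1 \x^ m2)%E)) //.
by move=> *; exact: product_measure2E.
Qed.

Section linear_change.
Context {R : realType}.

Lemma measurable_mulmx m n (T : 'M[R]_(m, n)) :
  measurable_fun [set: 'cV[R]_n] (fun x : 'cV[R]_n => T *m x : 'cV[R]_m).
Proof.
apply: measurable_fun_cV => i.
rewrite (_ : (fun _ => _) = fun x : 'cV[R]_n => \sum_j T i j * x j ord0).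
  by apply: measurable_sum => j; apply: measurable_funM => //; exact: measurable_coord_cV.
by apply/funext => x; rewrite mxE.
Qed.

Lemma lebesgue_cV_trans n (c : 'cV[R]_n) (A : set 'cV[R]_n) : measurable A ->
  lebesgue_cV n ((fun x => c + x) @^-1` A) = lebesgue_cV n A.
Proof.
move=> mA.
have mf : measurable_fun [set: 'cV[R]_n] (fun x : 'cV[R]_n => c + x).
  apply: measurable_fun_cV => i.
  rewrite (_ : (fun _ => _) = fun x : 'cV[R]_n => c i ord0 + x i ord0).
    by apply: measurable_funD => //; exact: measurable_coord_cV.
  by apply/funext => x; rewrite mxE.
have sh a b : (fun x => c + x) @^-1` obox a b = obox (a - c) (b - c).
  apply/seteqP; split=> x /= h i; have := h i; rewrite /= !in_itv /= !mxE.
    by rewrite ltrBlDl ltrBrDl.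
  by rewrite ltrBlDl ltrBrDl.
apply: (@eq_measure_oboxes _ _ (push_measure (lebesgue_cV n) mf)) => // a b;
  rewrite /= /pushforward sh; last exact: lebesgue_cV_obox_lty.
rewrite !lebesgue_cV_obox; apply: eq_bigr => i _.
rewrite !lebesgue_measure_itv /= !mxE !lte_fin ltrD2r; case: ifP => // _.
by rewrite -!EFinB; congr (_%:E); ring.
Qed.

Lemma lebesgue_cV_perm n (s : 'S_n) (A : set 'cV[R]_n) : measurable A ->
  lebesgue_cV n (mulmx (perm_mx s) @^-1` A) = lebesgue_cV n A.
Proof.
move=> mA.
have sh a b : mulmx (perm_mx s) @^-1` obox a b =
    obox (perm_mx s^-1 *m a) (perm_mx s^-1 *m b) :> set 'cV[R]_n.
  apply/seteqP; split=> x /=; rewrite -!row_permE => h i.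
    by have := h (s^-1 i)%g; rewrite /= !mxE permKV.
  by have := h (s i)%g; rewrite /= !mxE permK.
apply: (@eq_measure_oboxes _ _ (push_measure (lebesgue_cV n) (measurable_mulmx (perm_mx s)))) => // a b;
  rewrite /= /pushforward sh; last exact: lebesgue_cV_obox_lty.
rewrite !lebesgue_cV_obox (reindex_inj (@perm_inj _ s)); apply: eq_bigr => i _.
by rewrite -!row_permE !mxE permK.
Qed.

(** The change of variables formula in terms of preimages: Lebesgue measure is [|\det T|] times its
    own pushforward under [T]. *)
Definition lebesgue_scales n (T : 'M[R]_n) := forall A : set 'cV[R]_n, measurable A ->
  lebesgue_cV n A = (`|\det T|%:E * lebesgue_cV n (mulmx T @^-1` A))%E.

Lemma measurable_mulmx_preimage m n (T : 'M[R]_(m, n)) (A : set 'cV[R]_m) : measurable A ->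
  measurable ((mulmx T @^-1` A) : set 'cV[R]_n).
Proof. by move=> mA; rewrite -[X in measurable X]setTI; exact: measurable_mulmx. Qed.

Lemma lebesgue_scales_mul n (S T : 'M[R]_n) :
  lebesgue_scales S -> lebesgue_scales T -> lebesgue_scales (S *m T).
Proof.
move=> hS hT A mA; rewrite hS // (hT (mulmx S @^-1` A)); last exact: measurable_mulmx_preimage.
rewrite muleA -EFinM -normrM det_mulmx; congr (_ * lebesgue_cV n _)%E.
by apply/seteqP; split => x; rewrite /= mulmxA.
Qed.

Lemma lebesgue_scales_integral n (T : 'M[R]_n) (D : set 'cV[R]_n) (g : 'cV[R]_n -> \bar R) :
  lebesgue_scales T -> measurable D -> measurable_fun D g -> (forall x, D x -> 0 <= g x)%E ->
  (\int[lebesgue_cV n]_(x in D) g x =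
   `|\det T|%:E * \int[lebesgue_cV n]_(x in mulmx T @^-1` D) g (T *m x))%E.
Proof.
move=> hT mD mg g0.
pose m := push_measure (lebesgue_cV n) (measurable_mulmx T).
rewrite (@eq_measure_integral _ _ _ _ (mscale (NngNum (normr_ge0 (\det T))) m)); last first.
  by move=> A mA _; exact: hT.
rewrite ge0_integral_mscale //= ge0_integral_pushforward //; first exact: measurable_mulmx.
by move=> x /set_mem; exact: g0.
Qed.

Lemma cons_cV_block n (a : R) (b : 'rV[R]_n) (c : 'cV[R]_n) (S : 'M[R]_n) (x : R * 'cV[R]_n) :
  (block_mx a%:M b c S : 'M[R]_n.+1) *m cons_cV x =
  cons_cV (a * x.1 + (b *m x.2) ord0 ord0, x.1 *: c + S *m x.2).
Proof.
rewrite /cons_cV /=; apply: (etrans (mul_block_col (a%:M : 'M[R]_1) b c S ((x.1 : R)%:M : 'M[R]_1) x.2)).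
congr col_mx; last by rewrite mul_mx_scalar.
by rewrite -scalar_mxM raddfD /=; congr (_ + _); exact: mx11_scalar.
Qed.

(** A shear with determinant 1: at fixed first coordinate [x] it translates the slice by
    [x *: c]. *)
Lemma lebesgue_scales_lower n (c : 'cV[R]_n) :
  lebesgue_scales (block_mx 1%:M 0 c 1%:M : 'M[R]_n.+1).
Proof.
move=> A mA.
rewrite (_ : \det _ = 1); last by apply: (etrans (det_lblock (1%:M : 'M[R]_1) c (1%:M : 'M[R]_n))); rewrite !det1 mulr1.
rewrite normr1 mul1e /= /extend_cV /pushforward /product_measure1.
apply: eq_integral => x _ /=.
rewrite -(@lebesgue_cV_trans n (x *: c)); last first.
  apply: measurable_xsection; rewrite -[X in measurable X]setTI; exact: measurable_cons_cV.
rewrite !xsectionE; congr (lebesgue_cV n _); apply/funext => y /=.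
by rewrite cons_cV_block /= !mul1r mul0mx mxE addr0 mul1mx.
Qed.

(** Slicing at a fixed tail [y], the first coordinate undergoes the affine map with slope [a] and
    offset [b *m y]; the remaining integral over the tail is transformed by [S]. *)
Lemma lebesgue_scales_upper n (a : R) (b : 'rV[R]_n) (S : 'M[R]_n) : a != 0 ->
  lebesgue_scales S ->
  lebesgue_scales (block_mx a%:M b 0 S : 'M[R]_n.+1).
Proof.
move=> a0 hS A mA.
rewrite (_ : \det _ = a * \det S); last first.
  by apply: (etrans (det_ublock (a%:M : 'M[R]_1) b S)); rewrite det_scalar1.
pose B := cons_cV (n := n) @^-1` A.
have mB : measurable B by rewrite -[X in measurable X]setTI; exact: measurable_cons_cV.
pose U : 'M[R]_n.+1 := block_mx a%:M b 0 S.
pose C := cons_cV (n := n) @^-1` (mulmx U @^-1` A).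
have mC : measurable C.
  rewrite -[X in measurable X]setTI; apply: measurable_cons_cV => //.
  exact: measurable_mulmx_preimage.
rewrite /= /extend_cV /pushforward -/B -/C.
rewrite !product_measure_ysection //.
have mys : measurable_fun setT (fun y => lebesgue_measure (ysection B y)).
  exact: measurable_fun_ysection.
rewrite (lebesgue_scales_integral hS) // preimage_setT.
rewrite (eq_integral (fun y => `|a|%:E * lebesgue_measure (ysection C y)))%E; last first.
  move=> y _.
  have -> : ysection C y = (fun x => a * x + (b *m y) ord0 ord0) @^-1` ysection B (S *m y).
    by rewrite !ysectionE; apply/funext => x; rewrite /B /C /= cons_cV_block /= scaler0 add0r.
  by apply: lebesgue_measure_affine => //; exact: measurable_ysection.
rewrite ge0_integralZl //; last exact: measurable_fun_ysection.
by rewrite muleA -EFinM normrM mulrC.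
Qed.

Lemma block_mx_corner n (M : 'M[R]_(1 + n)) :
  M = block_mx (M ord0 ord0)%:M (ursubmx M) (dlsubmx M) (drsubmx M).
Proof.
rewrite -[LHS]submxK; congr block_mx; rewrite [LHS]mx11_scalar !mxE.
by congr ((M _ _)%:M); exact: val_inj.
Qed.

(** Induction on [n]: a column swap makes the corner entry nonzero, and block elimination then
    factors the matrix into a shear and a block triangular matrix with a smaller invertible
    block. *)
Lemma lebesgue_scales_unitmx n (T : 'M[R]_n) : T \in unitmx -> lebesgue_scales T.
Proof.
elim: n T => [|n IH] T uT.
  move=> A mA; rewrite det_mx00 normr1 mul1e; congr dirac.
  by apply/seteqP; split => x /=; rewrite (flatmx0 (T *m x)) (flatmx0 x).
(* A zero first row would make the determinant vanish. *)
have [j Tj] : exists j, T ord0 j != 0.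
  apply/existsP; apply: contraT; rewrite negb_exists => /forallP T0.
  move: uT; rewrite unitmxE (expand_det_row _ ord0) big1 ?unitr0 // => j _.
  by have := T0 j; rewrite negbK => /eqP ->; rewrite mul0r.
pose P : 'M[R]_n.+1 := tperm_mx ord0 j.
have PP : P *m P = 1%:M by rewrite /P /tperm_mx -perm_mxM tperm2 perm_mx1.
have sP : lebesgue_scales P.
  by move=> A mA; rewrite lebesgue_cV_perm // det_perm normrX normrN1 expr1n mul1e.
suff : lebesgue_scales (T *m P).
  by move=> /lebesgue_scales_mul /(_ sP); rewrite -mulmxA PP mulmx1.
have uTP : T *m P \in unitmx by rewrite unitmx_mul uT unitmx_perm.
pose T' : 'M[R]_(1 + n) := T *m P.
pose a := T' ord0 ord0.
have a0 : a != 0 by rewrite /a /T' /P /tperm_mx -tpermV -col_permE mxE tpermL.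
pose b := ursubmx T'; pose c := dlsubmx T'; pose D := drsubmx T'.
have eT' : T' = block_mx a%:M b c D := block_mx_corner T'.
(* The Schur complement of the corner [a]. *)
pose S := D - (a^-1 *: c) *m b.
have eLU : T' = block_mx 1%:M 0 (a^-1 *: c) 1%:M *m block_mx a%:M b 0 S.
  rewrite mulmx_block !mul1mx !mul0mx !addr0 eT'; congr block_mx.
    by rewrite mul_mx_scalar scalerA divff // scale1r.
  by rewrite /S addrC subrK.
have uS : S \in unitmx.
  have : T' \in unitmx := uTP.
  rewrite eLU unitmx_mul => /andP[_].
  by rewrite !unitmxE det_ublock unitrM => /andP[].
rewrite -/T' eLU; apply: lebesgue_scales_mul; first exact: lebesgue_scales_lower.
by apply: lebesgue_scales_upper => //; exact: IH.
Qed.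
End linear_change.

(** * Homogeneous functions on shells *)

Section shells.
Context {R : realType} {n : nat}.
Implicit Types (rho sigma : 'cV[R]_n -> R) (x : 'cV[R]_n) (e s : R) (k : int).

(** Covers the Euclidean norm and its composites with invertible matrices, whose shells are to be
    compared. *)
Definition gauge rho := [/\ measurable_fun setT rho,
  forall s x, 0 < s -> rho (s *: x) = s * rho x & forall x, x != 0 -> 0 < rho x].

(** Exponential radii make dilation by [expR (e * l%:~R)] shift the index by [l]; for [0 < e] and a
    gauge [rho] the shells over all integers partition the complement of the origin. *)
Definition shell rho e k : set 'cV[R]_n :=
  [set x | expR (e * k%:~R) <= rho x < expR (e * (k + 1)%:~R)].

Lemma measurable_shell rho e k : gauge rho -> measurable (shell rho e k).
Proof.
move=> [mrho _ _]; rewrite /shell -[X in measurable X]setTI.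
rewrite (_ : _ `&` _ = rho @^-1` `[expR (e * k%:~R), expR (e * (k + 1)%:~R)[%classic).
  by rewrite -[X in measurable X]setTI; apply: mrho.
by apply/seteqP; split=> x /=; rewrite in_itv //= => -[_ ->].
Qed.

Lemma shell_neq0 rho e k x : gauge rho -> shell rho e k x -> x != 0.
Proof.
move=> [_ hrho _] /andP[h _]; apply/eqP => x0; move: h; rewrite x0 leNgt.
(* Homogeneity forces [rho 0 = 0], which is below the positive lower bound of every shell. *)
have : rho 0 = 2 * rho 0 by rewrite -hrho // scaler0.
by move=> r0; have -> : rho 0 = 0; [lra|rewrite expR_gt0].
Qed.

Lemma shell_cover rho e x : 0 < e -> 0 < rho x -> exists k, shell rho e k x.
Proof.
move=> e0 r0; exists (Num.floor (ln (rho x) / e)); rewrite /shell /=.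
rewrite -[rho x]lnK ?posrE // ler_expR ltr_expR expRK.
have h : ln (rho x) / e \is Num.real by exact: num_real.
by rewrite -ler_pdivlMl // -ltr_pdivrMl // mulrC floor_le_tmp // mulrC floorD1_gt.
Qed.

Lemma shell_inj rho e k l x : 0 < e -> shell rho e k x -> shell rho e l x -> k = l.
Proof.
move=> e0 /andP[k1 k2] /andP[l1 l2].
have := le_lt_trans k1 l2; have := le_lt_trans l1 k2.
rewrite !ltr_expR !ltr_pM2l // !ltr_int !ltzD1 => a b.
by apply/eqP; rewrite eq_le a b.
Qed.

Lemma shell_scale rho e k l x : gauge rho ->
  shell rho e k (expR (e * l%:~R) *: x) = shell rho e (k - l) x.
Proof.
move=> [_ hrho _]; rewrite /shell /= hrho ?expR_gt0 //.
have -> : e * k%:~R = e * l%:~R + e * (k - l)%:~R by rewrite rmorphB /=; ring.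
have -> : e * (k + 1)%:~R = e * l%:~R + e * (k - l + 1)%:~R :> R.
  by rewrite !rmorphD /= rmorphN /=; ring.
by rewrite !expRD ler_pM2l ?expR_gt0 // ltr_pM2l ?expR_gt0.
Qed.

(** Degree [-n] is what makes the density [h] times Lebesgue measure invariant under dilations. *)
Definition homogeneous_inv (h : 'cV[R]_n -> \bar R) :=
  forall s x, 0 < s -> h (s *: x) = ((s ^- n)%:E * h x)%E.

(** A bijection from naturals to integers, since countable unions and series are indexed by [nat]:
    even codes give the nonnegative integers, odd ones the negative integers. *)
Definition int_of_code (m : nat) : int := if odd m then Negz m./2 else Posz m./2.

Lemma int_of_code_inj : injective int_of_code.
Proof.
move=> a b; rewrite /int_of_code; case: ifP => oa; case: ifP => ob // -[ab].
  by rewrite -(odd_double_half a) -(odd_double_half b) oa ob ab.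
by rewrite -(odd_double_half a) -(odd_double_half b) oa ob ab.
Qed.

Lemma int_of_code_surj k : exists m, int_of_code m = k.
Proof.
case: k => k; [exists k.*2 | exists k.*2.+1]; rewrite /int_of_code /=.
  by rewrite odd_double doubleK.
by rewrite odd_double /= uphalf_double.
Qed.

Lemma integral_shell_split rho sigma e (f : nat -> int) (h : 'cV[R]_n -> \bar R) :
  0 < e -> gauge rho -> gauge sigma ->
  injective f -> (forall k, exists m, f m = k) ->
  measurable_fun setT h -> (forall x, 0 <= h x)%E ->
  (\int[lebesgue_cV n]_(x in shell rho e 0) h x =
   \sum_(0 <= m <oo) \int[lebesgue_cV n]_(x in shell rho e 0 `&` shell sigma e (f m)) h x)%E.
Proof.
move=> e0 g1 g2 fi fs mh h0.
have eb : shell rho e 0 = \bigcup_m (shell rho e 0 `&` shell sigma e (f m)).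
  apply/seteqP; split => x /=; last by move=> [m _ []].
  move=> rx; have [|k hk] := @shell_cover sigma e x e0.
    by case: g2 => _ _; apply; exact: shell_neq0 rx.
  by have [m fm] := fs k; exists m => //; split => //; rewrite fm.
rewrite {1}eb ge0_integral_bigcup //.
- by move=> m; apply: measurableI; exact: measurable_shell.
- exact: measurable_funTS.
- apply/trivIsetP => i j _ _ ij; apply/seteqP; split => // x [[_ si] [_ sj]].
  by move: ij; rewrite (fi _ _ (shell_inj e0 si sj)) eqxx.
Qed.

(* [h] times Lebesgue measure is invariant under dilations, so all fundamental
   domains of the dilation by [expR e] have the same mass. *)
Lemma integral_shell_gauge rho sigma e (h : 'cV[R]_n -> \bar R) :
  0 < e -> gauge rho -> gauge sigma ->
  measurable_fun setT h -> (forall x, 0 <= h x)%E -> homogeneous_inv h ->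
  (\int[lebesgue_cV n]_(x in shell rho e 0) h x =
   \int[lebesgue_cV n]_(x in shell sigma e 0) h x)%E.
Proof.
move=> e0 g1 g2 mh h0 hh.
(* Dilation matches the piece of index [k] in the first decomposition with the piece of index [- k]
   in the second, so the second is enumerated with opposite signs. *)
have inj_opp : injective (fun m => - int_of_code m).
  by move=> i j /oppr_inj; exact: int_of_code_inj.
have surj_opp k : exists m, - int_of_code m = k.
  by have [m hm] := int_of_code_surj (- k); exists m; rewrite hm opprK.
rewrite [LHS](integral_shell_split e0 g1 g2 int_of_code_inj int_of_code_surj mh h0).
rewrite [RHS](integral_shell_split e0 g2 g1 inj_opp surj_opp mh h0).
apply: eq_eseriesr => m _; set k := int_of_code m.
pose s := expR (e * k%:~R); have s0 : 0 < s by exact: expR_gt0.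
have uS : (s%:M : 'M[R]_n) \in unitmx by rewrite unitmxE det_scalar unitfE expf_neq0 ?gt_eqF.
have mD : measurable (shell rho e 0 `&` shell sigma e k) by apply: measurableI; exact: measurable_shell.
rewrite (lebesgue_scales_integral (lebesgue_scales_unitmx uS) mD) //; last exact: measurable_funTS.
rewrite (_ : mulmx s%:M @^-1` _ = shell sigma e 0 `&` shell rho e (- k)); last first.
  apply/seteqP; split => x /=; rewrite mul_scalar_mx !shell_scale // sub0r subrr => -[] //.
have mD' : measurable (shell sigma e 0 `&` shell rho e (- k)) by apply: measurableI; exact: measurable_shell.
rewrite (eq_integral (fun x => (s ^- n)%:E * h x)%E); last first.
  by move=> x _; rewrite mul_scalar_mx hh.
rewrite ge0_integralZl //; last 2 first.
- exact: measurable_funTS.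
- by rewrite lee_fin invr_ge0 exprn_ge0 // ltW.
(* The Jacobian [s ^+ n] of the dilation cancels the factor [s ^- n] from homogeneity. *)
rewrite muleA -EFinM det_scalar ger0_norm ?exprn_ge0 1?ltW //.
by rewrite mulfV ?mul1e // expf_neq0 // gt_eqF.
Qed.

Lemma homogeneous_inv_mulmx (h : 'cV[R]_n -> \bar R) (M : 'M[R]_n) :
  homogeneous_inv h -> homogeneous_inv (fun x => h (M *m x)).
Proof. by move=> hh s x s0; rewrite -scalemxAr hh. Qed.

Lemma gauge_mulmx rho (T : 'M[R]_n) : T \in unitmx -> gauge rho -> gauge (fun x => rho (T *m x)).
Proof.
move=> uT [m h p]; split.
- exact: (measurableT_comp m (measurable_mulmx T)).
- by move=> s x s0; rewrite -scalemxAr h.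
- move=> x x0; apply: p; apply: contra x0 => /eqP Tx0.
  by rewrite -(mulKmx uT x) Tx0 mulmx0.
Qed.

(** The shells of [rho] and of [rho] composed with [invmx M] have the same mass, and the
    substitution by [M] carries the latter back to the shell of [rho]. *)
Lemma integral_shell_mulmx rho e (h : 'cV[R]_n -> \bar R) (M : 'M[R]_n) :
  0 < e -> gauge rho -> M \in unitmx ->
  measurable_fun setT h -> (forall x, 0 <= h x)%E -> homogeneous_inv h ->
  (`|\det M|%:E * \int[lebesgue_cV n]_(x in shell rho e 0) h (M *m x) =
   \int[lebesgue_cV n]_(x in shell rho e 0) h x)%E.
Proof.
move=> e0 g uM mh h0 hh.
have uM' : invmx M \in unitmx by rewrite unitmx_inv.
have g' := gauge_mulmx uM' g.
rewrite [RHS](integral_shell_gauge e0 g g' mh h0 hh).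
rewrite [RHS](lebesgue_scales_integral (lebesgue_scales_unitmx uM)); last first.
- by move=> x _; exact: h0.
- exact: measurable_funTS.
- exact: measurable_shell.
congr (_ * integral _ _ _)%E.
by apply/funext => x; rewrite /shell /= mulKmx.
Qed.

End shells.

(** * Rotations *)

Section rotations.
Context {R : realType} {n : nat}.
Implicit Types (x y u v w : 'cV[R]_n) (Q : 'M[R]_n).

Lemma dotcvE u v : dotcv u v = (u^T *m v) ord0 ord0.
Proof. by rewrite mxE; apply: eq_bigr => i _; rewrite mxE. Qed.

Lemma dotcvC u v : dotcv u v = dotcv v u.
Proof. by apply: eq_bigr => i _; rewrite mulrC. Qed.

Lemma dotcvDl u v w : dotcv (u + v) w = dotcv u w + dotcv v w.
Proof. by rewrite !dotcvE linearD mulmxDl mxE. Qed.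

Lemma dotcvZl s u v : dotcv (s *: u) v = s * dotcv u v.
Proof. by rewrite !dotcvE linearZ -scalemxAl mxE. Qed.

Lemma dotcvDr u v w : dotcv w (u + v) = dotcv w u + dotcv w v.
Proof. by rewrite dotcvC dotcvDl !(dotcvC w). Qed.

Lemma dotcvZr s u v : dotcv u (s *: v) = s * dotcv u v.
Proof. by rewrite dotcvC dotcvZl dotcvC. Qed.

Lemma dotcvNl u v : dotcv (- u) v = - dotcv u v.
Proof. by rewrite -scaleN1r dotcvZl mulN1r. Qed.

Lemma dotcvNr u v : dotcv v (- u) = - dotcv v u.
Proof. by rewrite dotcvC dotcvNl dotcvC. Qed.

Lemma dotcv_ge0 u : 0 <= dotcv u u.
Proof. by apply: sumr_ge0 => i _; rewrite -expr2 sqr_ge0. Qed.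

Lemma sqr_coord_le_dotcv u i : u i ord0 ^+ 2 <= dotcv u u.
Proof.
rewrite /dotcv (bigD1 i) //= -expr2 lerDl.
by apply: sumr_ge0 => j _; rewrite -expr2 sqr_ge0.
Qed.

Lemma dotcv_gt0 u : u != 0 -> 0 < dotcv u u.
Proof.
move=> u0; rewrite lt_neqAle dotcv_ge0 andbT eq_sym; apply: contra u0 => /eqP d0.
apply/eqP/matrixP => i j; rewrite ord1 mxE; apply/eqP.
by rewrite -sqrf_eq0 eq_le sqr_ge0 andbT -d0 sqr_coord_le_dotcv.
Qed.

Lemma dotcv_mulmx Q u v : Q^T *m Q = 1%:M -> dotcv (Q *m u) (Q *m v) = dotcv u v.
Proof. by move=> QQ; rewrite !dotcvE trmx_mul -mulmxA (mulmxA Q^T) QQ mul1mx. Qed.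

(** Sylvester's determinant identity: each side is the determinant of the block matrix [M], after
    eliminating one or the other identity block. *)
Lemma det_mul1BC m k (A : 'M[R]_(m, k)) (B : 'M[R]_(k, m)) :
  \det (1%:M - A *m B) = \det (1%:M - B *m A).
Proof.
pose M := block_mx 1%:M A B 1%:M.
have e1 : M = block_mx 1%:M 0 B 1%:M *m block_mx 1%:M A 0 (1%:M - B *m A).
  by rewrite mulmx_block !mul1mx !mul0mx !mulmx1 !addr0 addrC subrK.
have e2 : M = block_mx 1%:M A 0 1%:M *m block_mx (1%:M - A *m B) 0 B 1%:M.
  by rewrite mulmx_block !mul1mx !mul0mx !mulmx1 !add0r subrK.
transitivity (\det M).
  by rewrite e2 det_mulmx det_ublock det_lblock !det1 !mul1r mulr1.
by rewrite e1 det_mulmx det_ublock det_lblock !det1 !mul1r.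
Qed.

(** The Householder reflection in the hyperplane orthogonal to [w]. *)
Definition reflection w : 'M[R]_n := 1%:M - (2 / dotcv w w) *: (w *m w^T).

Lemma reflectionE w x : reflection w *m x = x - (2 / dotcv w w * dotcv w x) *: w.
Proof.
rewrite mulmxBl mul1mx -scalemxAl -mulmxA [w^T *m x]mx11_scalar -dotcvE.
by rewrite mul_mx_scalar scalerA.
Qed.

Lemma tr_reflection w : (reflection w)^T = reflection w.
Proof. by rewrite linearB /= trmx1 linearZ /= trmx_mul trmxK. Qed.

Lemma reflectionK w : w != 0 -> reflection w *m reflection w = 1%:M.
Proof.
move=> w0; have d0 := dotcv_gt0 w0.
rewrite {1}/reflection mulmxBl mul1mx -scalemxAl -mulmxA.
have -> : w^T *m reflection w = - w^T.
  rewrite -{1}tr_reflection -trmx_mul reflectionE mulfVK ?gt_eqF //.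
  by rewrite scaler_nat mulr2n opprD addrA subrr sub0r linearN.
by rewrite mulmxN scalerN opprK /reflection subrK.
Qed.

(** Sylvester's identity reduces the rank-one perturbation of the identity to a 1 by 1
    determinant. *)
Lemma det_reflection w : w != 0 -> \det (reflection w) = -1.
Proof.
move=> w0; have d0 := dotcv_gt0 w0.
rewrite /reflection scalemxAl det_mul1BC -scalemxAr [w^T *m w]mx11_scalar -dotcvE.
rewrite scale_scalar_mx mulfVK ?gt_eqF // -raddfB /= det_scalar expr1.
by ring.
Qed.

Lemma exists_orthogonal v : (2 <= n)%N -> exists2 w, w != 0 & dotcv w v = 0.
Proof.
move=> n2; pose i := Ordinal (ltnW n2); pose j := Ordinal n2.
have ij : i != j by [].
pose d k : 'cV[R]_n := delta_mx k ord0.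
have dE k x : dotcv (d k) x = x k ord0.
  rewrite /dotcv (bigD1 k) //= mxE !eqxx mul1r big1 ?addr0 // => l lk.
  by rewrite mxE (negbTE lk) mul0r.
have [vj0|vj0] := eqVneq (v j ord0) 0.
  exists (d j); last by rewrite dE.
  by apply/eqP => /matrixP /(_ j ord0) /eqP; rewrite !mxE !eqxx oner_eq0.
exists (v j ord0 *: d i - v i ord0 *: d j).
  apply/eqP => /matrixP /(_ i ord0); rewrite !mxE !eqxx (negbTE ij) mulr1 mulr0 subr0.
  by apply/eqP.
by rewrite dotcvDl dotcvNl !dotcvZl !dE mulrC subrr.
Qed.

(** The reflection in [u - v] takes [u] to [v]; a second reflection in some [w] orthogonal to [v]
    fixes [v] and restores determinant 1. *)
Lemma rotation_transitive u v : (2 <= n)%N -> usphere u -> usphere v ->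
  exists Q, [/\ Q^T *m Q = 1%:M, \det Q = 1 & Q *m u = v].
Proof.
rewrite /usphere /= => n2 u1 v1; have [<-|uv] := eqVneq u v.
  by exists 1%:M; rewrite trmx1 mul1mx det1 mul1mx.
have [w w0 wv] := exists_orthogonal v n2.
have uv0 : u - v != 0 by rewrite subr_eq0.
exists (reflection w *m reflection (u - v)); split.
- rewrite trmx_mul !tr_reflection mulmxA -(mulmxA (reflection (u - v))).
  by rewrite reflectionK // mulmx1 reflectionK.
- by rewrite det_mulmx !det_reflection // mulrNN mulr1.
rewrite -mulmxA (reflectionE (u - v)).
have := dotcv_gt0 uv0.
(* This uses that [u] and [v] have equal norm. *)
have -> : dotcv (u - v) (u - v) = 2 * dotcv (u - v) u.
  rewrite !dotcvDl !dotcvDr !dotcvNl !dotcvNr u1 v1 (dotcvC v u); ring.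
rewrite pmulr_rgt0 // => d0.
have -> : 2 / (2 * dotcv (u - v) u) * dotcv (u - v) u = 1.
  by field; rewrite gt_eqF.
by rewrite scale1r opprB addrC subrK reflectionE wv mulr0 scale0r subr0.
Qed.

Definition enorm x : R := Num.sqrt (dotcv x x).

Lemma enormZ s x : 0 < s -> enorm (s *: x) = s * enorm x.
Proof.
move=> s0; rewrite /enorm dotcvZl dotcvZr mulrA -expr2 sqrtrM ?sqr_ge0 //.
by rewrite sqrtr_sqr gtr0_norm.
Qed.

Lemma enorm_gt0 x : x != 0 -> 0 < enorm x.
Proof. by move=> x0; rewrite sqrtr_gt0 dotcv_gt0. Qed.

Lemma measurable_dotcv d (X : measurableType d) (f g : X -> 'cV[R]_n) :
  measurable_fun setT f -> measurable_fun setT g ->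
  measurable_fun setT (fun t => dotcv (f t) (g t)).
Proof.
move=> mf mg; apply: measurable_sum => i; apply: measurable_funM.
  exact: (measurableT_comp (measurable_coord_cV (T2 := measurableTypeR R) i) mf).
exact: (measurableT_comp (measurable_coord_cV (T2 := measurableTypeR R) i) mg).
Qed.

Lemma measurable_sqrtr : measurable_fun setT (@Num.sqrt R).
Proof. by apply: continuous_measurable_fun => x; exact: sqrt_continuous. Qed.

Lemma gauge_enorm : gauge enorm.
Proof.
split; last exact: enorm_gt0.
  apply: (measurableT_comp measurable_sqrtr).
  exact: measurable_dotcv.
by move=> s x; exact: enormZ.
Qed.

End rotations.

(** * Uniqueness of the invariant measure on the sphere *)

Lemma measure_mono dX (X : measurableType dX) (R : realType) (m : {measure set X -> \bar R})
  (A B : set X) : measurable A -> measurable B -> A `<=` B -> (m A <= m B)%E.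
Proof. by move=> mA mB AB; apply: le_measure => //; exact/mem_set. Qed.

Section sphere_uniqueness.
Context {R : realType} {n : nat}.
Implicit Types (x u v w : 'cV[R]_n) (E F : set 'cV[R]_n) (P : probability 'cV[R]_n R) (d : R).

Lemma measurable_usphere : measurable (@usphere R n).
Proof.
rewrite /usphere -[X in measurable X]setTI.
exact: (measurable_dotcv (@measurable_id _ _ _) (@measurable_id _ _ _) measurableT (measurable_set1 (1 : measurableTypeR R))).
Qed.

(** A full Euclidean ball; only its trace on the sphere, a spherical cap, is seen by measures
    carried by the sphere. *)
Definition cap u d : set 'cV[R]_n := [set w | dotcv (w - u) (w - u) < d ^+ 2].

(** Measuring this set by slices in both directions is the double count behind uniqueness. *)
Definition close_pairs E F d : set ('cV[R]_n * 'cV[R]_n) :=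
  [set z | [/\ (E `&` usphere) z.1, (F `&` usphere) z.2 & cap z.1 d z.2]].

Lemma measurable_subcV dX (X : measurableType dX) (f g : X -> 'cV[R]_n) :
  measurable_fun setT f -> measurable_fun setT g ->
  measurable_fun setT (fun t => f t - g t).
Proof.
move=> mf mg; apply: measurable_fun_cV => i.
rewrite (_ : (fun _ => _) = fun t => f t i ord0 - g t i ord0).
  apply: measurable_funB.
    exact: (measurableT_comp (measurable_coord_cV (T2 := measurableTypeR R) i) mf).
  exact: (measurableT_comp (measurable_coord_cV (T2 := measurableTypeR R) i) mg).
by apply/funext => x; rewrite !mxE.
Qed.

Lemma measurable_close_pairs E F d : measurable E -> measurable F ->
  measurable (close_pairs E F d).
Proof.
move=> mE mF.
rewrite (_ : close_pairs E F d = ((E `&` usphere) `*` (F `&` usphere)) `&`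
  ((fun z : 'cV[R]_n * 'cV[R]_n => dotcv (z.2 - z.1) (z.2 - z.1)) @^-1` `]-oo, d ^+ 2[%classic)).
  apply: measurableI.
    by apply: measurableX; apply: measurableI => //; exact: measurable_usphere.
  rewrite -[X in measurable X]setTI; apply: measurable_dotcv => //.
    by apply: measurable_subcV.
  by apply: measurable_subcV.
by apply/seteqP; split => z /=; rewrite /cap /= in_itv /= => -[] // [].
Qed.

Lemma measurable_cap u d : measurable (cap u d).
Proof.
rewrite (_ : cap u d = (fun z : 'cV[R]_n => dotcv (z - u) (z - u)) @^-1` `]-oo, d ^+ 2[%classic).
  rewrite -[X in measurable X]setTI; apply: measurable_dotcv => //;
  by apply: measurable_subcV.
by apply/seteqP; split => z /=; rewrite /cap /= in_itv.
Qed.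

Lemma probability_setI P (S E : set 'cV[R]_n) : P S = 1%E -> measurable S -> measurable E ->
  P (E `&` S) = P E.
Proof.
move=> PS mS mE; rewrite [RHS](measureDI _ mE mS).
rewrite [X in (X + _)%E](_ : _ = 0%E) ?add0e //.
apply/eqP; rewrite eq_le measure_ge0 andbT.
apply: (@le_trans _ _ (P (~` S))); last by rewrite probability_setC // PS subee.
by apply: measure_mono; [exact: measurableD|exact: measurableC|move=> x []].
Qed.

Lemma integral_cst_indic P (c : R) (f : 'cV[R]_n -> \bar R) E : measurable E ->
  (forall x, f x = (c * \1_E x)%:E) -> (\int[P]_x f x = c%:E * P E)%E.
Proof.
move=> mE fE; rewrite (eq_integral (fun x => c%:E * (\1_E x)%:E)%E); last by move=> x _; rewrite fE EFinM.
rewrite integralZl //; last exact: integrable_indic.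
by rewrite integral_indic // setIT.
Qed.

Section two.
Variables (P1 P2 : probability 'cV[R]_n R) (d : R).
Hypotheses (S1 : P1 usphere = 1%E) (S2 : P2 usphere = 1%E).

(** The slice at [x] is a cap of mass [c] up to a null set when [x] lies in [E] and on the sphere,
    and is empty otherwise. *)
Lemma close_pairs_left (c : R) E : measurable E ->
  (forall u, usphere u -> P2 (cap u d) = c%:E) ->
  (P1 \x P2)%E (close_pairs E setT d) = (c%:E * P1 E)%E.
Proof.
move=> mE hc; rewrite -(probability_setI S1) //; last exact: measurable_usphere.
apply: integral_cst_indic; first by apply: measurableI => //; exact: measurable_usphere.
move=> x /=; rewrite xsectionE indicE.
have [xES|xES] := boolP (x \in E `&` usphere).
  rewrite mulr1 -(hc x); last by move/set_mem : xES => [].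
  rewrite -(probability_setI S2 measurable_usphere (measurable_cap x d)).
  congr (P2 _); apply/seteqP; split => w /=; rewrite /close_pairs /=.
    by move=> [_ [_ ?] ?].
  by move=> [? ?]; split => //; exact: set_mem.
rewrite mulr0 (_ : _ @^-1` _ = set0) ?measure0 //.
apply/seteqP; split => w //= -[xE _ _].
by move: xES; rewrite mem_set.
Qed.

Lemma close_pairs_right (c : R) F : measurable F ->
  (forall u, usphere u -> P1 (cap u d) = c%:E) ->
  (P1 \x P2)%E (close_pairs setT F d) = (c%:E * P2 F)%E.
Proof.
move=> mF hc; rewrite product_measure_ysection; last exact: measurable_close_pairs.
rewrite -(probability_setI S2) //; last exact: measurable_usphere.
apply: integral_cst_indic; first by apply: measurableI => //; exact: measurable_usphere.
move=> x; rewrite ysectionE indicE.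
have [xES|xES] := boolP (x \in F `&` usphere).
  rewrite mulr1 -(hc x); last by move/set_mem : xES => [].
  rewrite -(probability_setI S1 measurable_usphere (measurable_cap x d)).
  have capC w : cap w d x = cap x d w.
    by rewrite /cap /= -opprB dotcvNl dotcvNr opprK.
  congr (P1 _); apply/seteqP; split => w /=; rewrite /close_pairs /= capC.
    by move=> [[_ ?] _ ?].
  by move=> [? ?]; split => //; exact: set_mem.
rewrite mulr0 (_ : _ @^-1` _ = set0) ?measure0 //.
apply/seteqP; split => w //= -[_ xE _].
by move: xES; rewrite mem_set.
Qed.

(** Both constants are the product measure of the set of all [d]-close pairs on the sphere. *)
Lemma cap_measure_agree (c1 c2 : R) :
  (forall u, usphere u -> P1 (cap u d) = c1%:E) ->
  (forall u, usphere u -> P2 (cap u d) = c2%:E) -> c1 = c2.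
Proof.
move=> h1 h2; have := close_pairs_left measurableT h2.
by rewrite (close_pairs_right measurableT h1) !probability_setT !mule1 => -[].
Qed.

(** Close pairs starting in [E] are close pairs ending in [F]; the two slicings give [c * P1 E] and
    [c * P2 F], and [c] cancels. *)
Lemma measure_le_thickening (c : R) E F : 0 < c -> measurable E -> measurable F ->
  (forall u, usphere u -> P1 (cap u d) = c%:E) ->
  (forall u, usphere u -> P2 (cap u d) = c%:E) ->
  (forall x w, E x -> cap x d w -> F w) -> (P1 E <= P2 F)%E.
Proof.
move=> c0 mE mF h1 h2 EF.
rewrite -(@lee_pmul2l _ c%:E) ?lte_fin //.
rewrite -(close_pairs_left mE h2) -(close_pairs_right mF h1).
apply: measure_mono; [exact: measurable_close_pairs..|].
move=> [x w] [/= [xE xS] [_ wS] xw]; split => //=; split => //.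
exact: EF xw.
Qed.

End two.

(** The box is the increasing union of the boxes shrunk by [e k]; thickening a shrunk box by [e k]
    stays inside the original one, and continuity from below concludes. *)
Lemma sphere_measure_le P1 P2 : P1 usphere = 1%E -> P2 usphere = 1%E ->
  (forall d, 0 < d -> exists c : R, [/\ 0 < c,
    forall u, usphere u -> P1 (cap u d) = c%:E &
    forall u, usphere u -> P2 (cap u d) = c%:E]) ->
  forall a b, (P1 (obox a b) <= P2 (obox a b))%E.
Proof.
move=> S1 S2 hc a b.
pose e k : R := k.+1%:R^-1.
have e0 k : 0 < e k by rewrite invr_gt0.
pose F k := obox (a + const_mx (e k)) (b - const_mx (e k)).
have ndF : nondecreasing_seq F.
  move=> k l kl; apply/subsetPset => x Fx i; have := Fx i.
  have : e l <= e k by rewrite lef_pV2 ?posrE // ler_nat.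
  rewrite /= !in_itv /= !mxE; move: (a i ord0) (b i ord0) (x i ord0) (e k) (e l) => A B X K L.
  by move=> h /andP[h1 h2]; apply/andP; split; lra.
have UF : \bigcup_k F k = obox a b.
  apply/seteqP; split => x.
    move=> [k _ Fx] i; have := Fx i; have := e0 k.
    rewrite /= !in_itv /= !mxE; move: (a i ord0) (b i ord0) (x i ord0) (e k) => A B X K.
    by move=> h /andP[h1 h2]; apply/andP; split; lra.
  move=> bx.
  (* The distance from coordinate [i] to the nearer face. The index chosen next dominates every
     truncated reciprocal, so its [e] is below all [r i]. *)
  pose r i := Num.min (x i ord0 - a i ord0) (b i ord0 - x i ord0).
  have r0 i : 0 < r i.
    by have := bx i; rewrite /= in_itv /= /r lt_min !subr_gt0.
  exists (\sum_i (Num.truncn (r i)^-1))%N => // i.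
  have : e (\sum_i (Num.truncn (r i)^-1))%N < r i.
    rewrite /e -[ltRHS]invrK ltf_pV2 ?posrE ?invr_gt0 //.
    apply: (lt_le_trans (truncnS_gt _)); rewrite ler_nat ltnS.
    by rewrite (bigD1 i) //= leq_addr.
  rewrite /= /r lt_min in_itv /= !mxE; move: (e _) => K /andP[h1 h2].
  by apply/andP; split; lra.
have := @nondecreasing_cvg_mu _ _ _ P1 F (fun k => measurable_obox _ _).
rewrite UF => /(_ (measurable_obox _ _) ndF) cF.
rewrite -(cvg_lim _ cF) //; apply: lime_le; first by apply/cvg_ex; eexists; exact: cF.
apply: nearW => k; have [c [c0 h1 h2]] := hc _ (e0 k).
apply: (measure_le_thickening S1 S2 c0 _ _ h1 h2); [exact: measurable_obox..|].
move=> x w Fx xw i; have := Fx i.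
have : `|w i ord0 - x i ord0| < e k.
  rewrite -(@ltr_pXn2r _ 2) ?nnegrE //; last exact: ltW.
  rewrite real_normK ?num_real //; apply: le_lt_trans xw.
  by have := sqr_coord_le_dotcv (w - x) i; rewrite !mxE.
rewrite ltr_norml /= !in_itv /= !mxE => /andP[h3 h4] /andP[h5 h6].
by apply/andP; split; lra.
Qed.

Lemma sphere_measure_eq P1 P2 : P1 usphere = 1%E -> P2 usphere = 1%E ->
  (forall d, 0 < d -> exists c : R, [/\ 0 < c,
    forall u, usphere u -> P1 (cap u d) = c%:E &
    forall u, usphere u -> P2 (cap u d) = c%:E]) ->
  forall A, measurable A -> P1 A = P2 A.
Proof.
move=> S1 S2 hc; apply: eq_measure_oboxes => a b.
  apply/eqP; rewrite eq_le !sphere_measure_le // => d /hc [c [? ? ?]].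
  by exists c; split.
by rewrite (le_lt_trans (probability_le1 _ (measurable_obox _ _))) ?ltry.
Qed.

End sphere_uniqueness.

(** * Radial projection of an annulus *)

Section radial_pushforward.
Context {R : realType} {n : nat}.
Implicit Types (x u v w : 'cV[R]_n) (e d : R).

(** The part of [D] outside [A] is null for the restricted measure, and the two measures agree on
    subsets of [A]. *)
Lemma integral_mrestr dX (X : measurableType dX) (m : {measure set X -> \bar R})
    (A D : set X) (mA : measurable A) (g : X -> \bar R) : measurable D -> A `<=` D ->
  measurable_fun D g -> (forall t, D t -> 0 <= g t)%E ->
  (\int[mrestr m mA]_(t in D) g t = \int[m]_(t in A) g t)%E.
Proof.
move=> mD AD mg g0.
have DA : D `\` (D `\` A) = A by rewrite setDD setIidr.
rewrite (@ge0_negligible_integral _ _ _ _ D (D `\` A)) //; last 2 first.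
- exact: measurableD.
- by rewrite /= /mrestr setDKI measure0.
rewrite DA; apply: eq_measure_integral => B mB BA.
by rewrite /= /mrestr setIidl.
Qed.

(** A ball of the sup norm contains a box with sides [r *+ 2]. *)
Lemma lebesgue_cV_gt0 x (V : set 'cV[R]_n) : measurable V -> (\forall y \near x, V y) ->
  (0 < lebesgue_cV n V)%E.
Proof.
move=> mV /nbhs_ballP [r /= r0 rV].
apply: (@lt_le_trans _ _ (lebesgue_cV n (obox (x - const_mx r) (x + const_mx r)))).
  rewrite lebesgue_cV_obox (eq_bigr (fun=> (r *+ 2)%:E)); last first.
    move=> i _; rewrite lebesgue_measure_itv /= !mxE lte_fin.
    by rewrite ltrBlDr -addrA ltrDl addr_gt0 // -EFinB; congr (_%:E); ring.
  by rewrite prodEFin lte_fin; apply: prodr_gt0 => i _; rewrite pmulrn_lgt0.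
apply: measure_mono => //; first exact: measurable_obox.
move=> y hy; apply: rV; split=> // i j; rewrite ord1; have := hy i.
rewrite /ball /= in_itv /= !mxE => /andP[h1 h2].
by rewrite ltr_norml; apply/andP; split; lra.
Qed.

Definition radial x : 'cV[R]_n := (enorm x)^-1 *: x.

Lemma enorm_sqr x : enorm x ^+ 2 = dotcv x x.
Proof. by rewrite sqr_sqrtr ?dotcv_ge0. Qed.

Lemma measurable_radial : measurable_fun setT radial.
Proof.
apply: measurable_fun_cV => i.
(* Writing the inverse as a real power gives access to the measurability of powers. *)
rewrite (_ : (fun _ => _) = fun x => (enorm x) `^ (-1) * x i ord0); last first.
  by apply/funext => x; rewrite mxE powR_inv1 // sqrtr_ge0.
apply: measurable_funM; last exact: measurable_coord_cV.
apply: (measurableT_comp (measurable_powR _)).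
by case: (@gauge_enorm R n).
Qed.

Lemma usphere_radial x : x != 0 -> usphere (radial x).
Proof.
move=> x0; rewrite /usphere /= dotcvZl dotcvZr -enorm_sqr.
by have := enorm_gt0 x0 => h; field; rewrite gt_eqF.
Qed.

Section annulus.
Variable e : R.
Hypothesis e0 : 0 < e.

Definition annulus : set 'cV[R]_n := shell enorm e 0.

Lemma measurable_annulus : measurable annulus.
Proof. by apply: measurable_shell; exact: gauge_enorm. Qed.

Lemma annulusE x : annulus x = (1 <= enorm x < expR e) :> Prop.
Proof. by rewrite /annulus /shell /= mulr0 expR0 add0r mulr1. Qed.

Lemma annulus_neq0 x : annulus x -> x != 0.
Proof. by apply: shell_neq0; exact: gauge_enorm. Qed.

Lemma annulus_lty : (lebesgue_cV n annulus < +oo)%E.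
Proof.
apply: (le_lt_trans _ (lebesgue_cV_obox_lty (const_mx (- expR e)) (const_mx (expR e)))).
apply: measure_mono; [exact: measurable_annulus|exact: measurable_obox|].
move=> x; rewrite annulusE => /andP[_ xe] i; rewrite /= in_itv /= !mxE -ltr_norml.
apply: le_lt_trans xe; rewrite -(@ler_pXn2r _ 2) ?nnegrE ?sqrtr_ge0 //.
by rewrite real_normK ?num_real // enorm_sqr sqr_coord_le_dotcv.
Qed.

Definition radial_cap u d := radial @^-1` cap u d `&` annulus.

Lemma measurable_radial_preimage (E : set 'cV[R]_n) : measurable E ->
  measurable (radial @^-1` E `&` annulus).
Proof.
move=> mE; apply: measurableI; last exact: measurable_annulus.
by rewrite -[X in measurable X]setTI; exact: measurable_radial.
Qed.

(** The law of cosines, turning membership of [radial x] in a cap into a strict inequality for a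
    function continuous away from the origin. *)
Lemma dotcv_radialB u x : usphere u -> x != 0 ->
  dotcv (radial x - u) (radial x - u) = 2 - 2 * (dotcv x u / enorm x).
Proof.
move=> u1 x0; rewrite !dotcvDl !dotcvDr !dotcvNl !dotcvNr (dotcvC u).
rewrite u1 (usphere_radial x0) dotcvZl; ring.
Qed.

Lemma continuous_sumr (T : topologicalType) (I : Type) (r : seq I) (f : I -> T -> R) :
  (forall i, continuous (f i)) -> continuous (fun t => \sum_(i <- r) f i t).
Proof.
move=> cf; elim: r => [|i r IH] x.
  by under eq_fun do rewrite big_nil; exact: cvg_cst.
under eq_fun do rewrite big_cons; apply: cvgD; first exact: cf.
exact: IH.
Qed.

Lemma continuous_dotcv (T : topologicalType) (f g : T -> 'cV[R]_n) :
  continuous f -> continuous g -> continuous (fun t => dotcv (f t) (g t)).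
Proof.
move=> cf cg; apply: continuous_sumr => i x; apply: cvgM.
  exact: (cvg_comp _ _ (cf x) (@coord_continuous R n 1 i ord0 (f x))).
exact: (cvg_comp _ _ (cg x) (@coord_continuous R n 1 i ord0 (g x))).
Qed.

Lemma continuous_enorm (T : topologicalType) (f : T -> 'cV[R]_n) :
  continuous f -> continuous (fun t => enorm (f t)).
Proof.
move=> cf t; apply: (@continuous_comp _ _ _ (fun t => dotcv (f t) (f t)) (@Num.sqrt R) t).
  exact: continuous_dotcv.
exact: sqrt_continuous.
Qed.

Lemma radial_cap_gt0 u d : usphere u -> 0 < d -> (0 < lebesgue_cV n (radial_cap u d))%E.
Proof.
(* The radius [s] lies strictly between the bounding radii 1 and [expR e], so a whole neighbourhood
   of [s *: u] lies in the radial cap. *)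
move=> u1 d0; pose s := expR (e / 2); have s0 : 0 < s := expR_gt0 _.
have nu : enorm u = 1 by rewrite /enorm u1 sqrtr1.
have ns : enorm (s *: u) = s by rewrite enormZ // nu mulr1.
have su0 : s *: u != 0.
  by apply/eqP => h; move: ns s0; rewrite h /enorm dotcvE mulmx0 mxE sqrtr0 => <-; rewrite ltxx.
have cn : enorm x @[x --> s *: u] --> s.
  rewrite -[X in _ --> X]ns.
  exact: (@continuous_enorm 'cV[R]_n id (fun x => cvg_id) (s *: u)).
have ck : dotcv x u / enorm x @[x --> s *: u] --> dotcv (s *: u) u / s.
  have cu : dotcv x u @[x --> s *: u] --> dotcv (s *: u) u.
    exact: (@continuous_dotcv 'cV[R]_n id (fun=> u) (fun x => cvg_id) (fun x => @cst_continuous _ _ u x) (s *: u)).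
  by apply: (cvgM cu (cvgV _ cn)); rewrite gt_eqF.
have k1 : dotcv (s *: u) u / s = 1.
  by rewrite dotcvZl u1 mulr1 divff // gt_eqF.
rewrite k1 in ck.
apply: (@lebesgue_cV_gt0 (s *: u)).
  by apply: measurable_radial_preimage; exact: measurable_cap.
have s1 : 1 < s by rewrite expR_gt1 divr_gt0.
have se : s < expR e by rewrite ltr_expR ltr_pdivrMr // ltr_pMr // ltr1n.
near=> x.
have h1 : 1 < enorm x by near: x; exact: (cvgr_gt _ cn).
have h2 : enorm x < expR e by near: x; exact: (cvgr_lt _ cn).
have h3 : 1 - d ^+ 2 / 2 < dotcv x u / enorm x.
  by near: x; apply: (cvgr_gt _ ck); rewrite gtrDl oppr_lt0 divr_gt0 // exprn_gt0.
have ax : annulus x by rewrite annulusE (ltW h1) h2.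
split => //; rewrite /= /cap /= dotcv_radialB //; last exact: annulus_neq0.
by lra.
Unshelve. all: by end_near.
Qed.

End annulus.
End radial_pushforward.

(** * Integration over the sphere and linear substitutions *)

Section sphere_integral.
Context {R : realType} {n : nat}.
Hypothesis n2 : (2 <= n)%N.
Implicit Types (x u v w : 'cV[R]_n) (e d : R).
Variable mu : probability 'cV[R]_n R.
Hypothesis hmu : is_sphere_measure mu.

Lemma usphere_nonempty : exists u, @usphere R n u.
Proof.
pose i := Ordinal (ltnW n2).
exists (delta_mx i ord0); rewrite /usphere /= /dotcv (bigD1 i) //= mxE !eqxx mul1r.
by rewrite big1 ?addr0 // => j ji; rewrite mxE (negbTE ji) mul0r.
Qed.

Lemma cap_rotate (Q : 'M[R]_n) u d : Q^T *m Q = 1%:M ->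
  [set Q *m x | x in cap u d] = cap (Q *m u) d.
Proof.
move=> QQ; have QQ' := mulmx1C QQ.
apply/seteqP; split => [_ [x hx <-]|y hy]; rewrite /cap /=.
  by rewrite -mulmxBr dotcv_mulmx.
exists (Q^T *m y); last by rewrite mulmxA QQ' mul1mx.
rewrite /cap /= -(dotcv_mulmx _ _ QQ) mulmxBr mulmxA QQ' mul1mx.
exact: hy.
Qed.

Lemma mu_cap u v d : usphere u -> usphere v -> mu (cap u d) = mu (cap v d).
Proof.
move=> uS vS; have [Q [QQ dQ <-]] := rotation_transitive n2 uS vS.
by rewrite -(cap_rotate _ _ QQ) (hmu.2 _ QQ dQ) //; exact: measurable_cap.
Qed.

(** Rotations preserve Lebesgue measure and the annulus, and commute with radial projection. *)
Lemma lebesgue_radial_cap e u v d : usphere u -> usphere v ->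
  lebesgue_cV n (radial_cap e u d) = lebesgue_cV n (radial_cap e v d).
Proof.
move=> uS vS; have [Q [QQ dQ <-]] := rotation_transitive n2 uS vS.
have uQ : Q \in unitmx by rewrite unitmxE dQ unitr1.
rewrite (lebesgue_scales_unitmx uQ (A := radial_cap e (Q *m u) d)); last first.
  by apply: measurable_radial_preimage; exact: measurable_cap.
rewrite dQ normr1 mul1e; congr (lebesgue_cV n _).
have enQ x : enorm (Q *m x) = enorm x by rewrite /enorm dotcv_mulmx.
apply/seteqP; split => x; rewrite /radial_cap /cap /= /annulus /shell /radial /= enQ;
  by rewrite scalemxAr -mulmxBr dotcv_mulmx.
Qed.

Section annulus_probability.
Variable e : R.
Hypothesis e0 : 0 < e.

Let A : set 'cV[R]_n := annulus e.

Lemma lebesgue_annulus_gt0 : 0 < fine (lebesgue_cV n A).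
Proof.
apply: fine_gt0; rewrite annulus_lty andbT.
have [u uS] := usphere_nonempty.
apply: (lt_le_trans (radial_cap_gt0 e0 uS ltr01)).
apply: measure_mono; last by move=> x [].
  by apply: measurable_radial_preimage; exact: measurable_cap.
exact: measurable_annulus.
Qed.

Lemma inv_lebesgue_annulus_ge0 : 0 <= (fine (lebesgue_cV n A))^-1.
Proof. by rewrite invr_ge0 ltW // lebesgue_annulus_gt0. Qed.

(** Normalized Lebesgue measure on the annulus, projected radially onto the sphere. *)
Definition radial_measure : set 'cV[R]_n -> \bar R :=
  mscale (NngNum inv_lebesgue_annulus_ge0)
    (push_measure (mrestr (lebesgue_cV n) (measurable_annulus e)) measurable_radial).

HB.instance Definition _ := Measure.copy radial_measure
  (mscale (NngNum inv_lebesgue_annulus_ge0)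
    (push_measure (mrestr (lebesgue_cV n) (measurable_annulus e)) measurable_radial)).

Lemma radial_measureE (E : set 'cV[R]_n) :
  radial_measure E = ((fine (lebesgue_cV n A))^-1%:E * lebesgue_cV n (radial @^-1` E `&` A))%E.
Proof. by []. Qed.

Lemma radial_measure_sub (E : set 'cV[R]_n) : A `<=` radial @^-1` E -> radial_measure E = 1%E.
Proof.
move=> AE; rewrite radial_measureE setIidr //.
rewrite -[X in (_ * X)%E]fineK; last by rewrite ge0_fin_numE ?measure_ge0 // annulus_lty.
by rewrite -EFinM mulVf // gt_eqF // lebesgue_annulus_gt0.
Qed.

Lemma radial_measure_setT : radial_measure setT = 1%E.
Proof. exact: radial_measure_sub. Qed.

HB.instance Definition _ := Measure_isProbability.Build _ _ _ radial_measure radial_measure_setT.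

(** For both measures the mass of a cap does not depend on its centre, so the uniqueness criterion
    applies. *)
Lemma sphere_measure_radial (E : set 'cV[R]_n) : measurable E ->
  mu E = radial_measure E.
Proof.
apply: sphere_measure_eq; first exact: hmu.1.
  by apply: radial_measure_sub => x /annulus_neq0; exact: usphere_radial.
have [u uS] := usphere_nonempty => d d0.
have fin (P : probability 'cV[R]_n R) : (fine (P (cap u d)))%:E = P (cap u d).
  by rewrite fineK // fin_num_measure //; exact: measurable_cap.
have h1 v : usphere v -> mu (cap v d) = (fine (mu (cap u d)))%:E.
  by move=> vS; rewrite fin; exact: mu_cap.
have h2 v : usphere v -> radial_measure (cap v d) = (fine (radial_measure (cap u d)))%:E.
  by move=> vS; rewrite fin; congr (_ * _)%E; exact: lebesgue_radial_cap.
have S2 : radial_measure usphere = 1%E.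
  by apply: radial_measure_sub => x /annulus_neq0; exact: usphere_radial.
exists (fine (mu (cap u d))); split => //.
  (* Positivity is read off the radial measure, where the cap corresponds to a set with interior. *)
  rewrite (cap_measure_agree hmu.1 S2 h1 h2) -lte_fin fin.
  apply: mule_gt0; last exact: radial_cap_gt0.
  by rewrite lte_fin invr_gt0 lebesgue_annulus_gt0.
by move=> v vS; rewrite (cap_measure_agree hmu.1 S2 h1 h2); exact: h2.
Qed.

Lemma integral_usphere (h : 'cV[R]_n -> \bar R) : measurable_fun setT h ->
  (forall x, 0 <= h x)%E ->
  (\int[mu]_(u in usphere) h u =
   (fine (lebesgue_cV n A))^-1%:E * \int[lebesgue_cV n]_(x in A) h (radial x))%E.
Proof.
move=> mh h0.
have mS : measurable (@usphere R n) := measurable_usphere.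
rewrite (@eq_measure_integral _ _ _ usphere radial_measure); last first.
  by move=> E mE _; exact: sphere_measure_radial.
rewrite ge0_integral_mscale //=; last exact: measurable_funTS.
rewrite ge0_integral_pushforward //; last 2 first.
- exact: measurable_radial.
- exact: measurable_funTS.
congr (_ * _)%E; apply: integral_mrestr.
- by rewrite -[X in measurable X]setTI; exact: measurable_radial.
- by move=> x /annulus_neq0; exact: usphere_radial.
- by apply: measurable_funTS; exact: (measurableT_comp mh measurable_radial).
- by move=> x _; exact: h0.
Qed.

Lemma homogeneous_radial (h : 'cV[R]_n -> \bar R) x : homogeneous_inv h -> x != 0 ->
  h (radial x) = ((enorm x ^+ n)%:E * h x)%E.
Proof. by move=> hh x0; rewrite hh ?invr_gt0 ?enorm_gt0 // exprVn invrK. Qed.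

(* On the annulus [1 <= |x| < exp e] the factor [|x| ^ n] separating [h (radial x)]
   from [h x] lies between [1] and [exp e ^ n]. *)
Lemma integral_usphere_mulmx_approx (h : 'cV[R]_n -> \bar R) (M : 'M[R]_n) :
  M \in unitmx -> measurable_fun setT h -> (forall x, 0 <= h x)%E -> homogeneous_inv h ->
  (`|\det M|%:E * \int[mu]_(u in usphere) h (M *m u) <=
   (expR e ^+ n)%:E * \int[mu]_(u in usphere) h u)%E.
Proof.
move=> uM mh h0 hh.
have mhM : measurable_fun setT (fun x => h (M *m x)).
  exact: (measurableT_comp mh (measurable_mulmx M)).
have hhM := homogeneous_inv_mulmx M hh.
have mA : measurable A := measurable_annulus e.
have mr (g : 'cV[R]_n -> \bar R) : measurable_fun setT g -> measurable_fun A (fun x => g (radial x)).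
  by move=> mg; apply: measurable_funTS; exact: (measurableT_comp mg measurable_radial).
rewrite (integral_usphere mhM (fun x => h0 _)) (integral_usphere mh h0).
rewrite muleCA [leRHS]muleCA; apply: lee_wpmul2l.
  by rewrite lee_fin invr_ge0 fine_ge0.
(* The middle term uses the integral of [h] itself over the annulus, for which the linear
   substitution is exact; each side then costs one comparison of [h] with its radial version. *)
apply: (@le_trans _ _ ((expR e ^+ n)%:E * \int[lebesgue_cV n]_(x in A) h x)%E).
  rewrite -(integral_shell_mulmx e0 gauge_enorm uM mh h0 hh) muleCA.
  apply: lee_wpmul2l; first by rewrite lee_fin.
  have g1 : measurable_fun A (fun x => h (M *m x)) by exact: measurable_funTS.
  have g2 : (0 <= (expR e ^+ n)%:E)%E by rewrite lee_fin exprn_ge0 // expR_ge0.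
  rewrite -(@ge0_integralZl _ _ _ (lebesgue_cV n) A mA _ g1 _ (fun x _ => h0 (M *m x)) g2).
  apply: ge0_le_integral => //.
  - exact: (mr _ mhM).
  - exact: measurable_funeM.
  move=> x Ax; rewrite (homogeneous_radial hhM (annulus_neq0 Ax)).
  apply: lee_wpmul2r => //; rewrite lee_fin; apply: lerXn2r; rewrite ?nnegrE ?sqrtr_ge0 ?expR_ge0 //.
  by move: Ax; rewrite /A annulusE => /andP[_ /ltW].
apply: lee_wpmul2l; first by rewrite lee_fin exprn_ge0 // expR_ge0.
apply: ge0_le_integral => //.
- exact: measurable_funTS.
- exact: (mr _ mh).
move=> x Ax; rewrite (homogeneous_radial hh (annulus_neq0 Ax)).
rewrite -[leLHS]mul1e; apply: lee_wpmul2r => //; rewrite lee_fin; apply: exprn_ege1.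
by move: Ax; rewrite /A annulusE => /andP[].
Qed.

End annulus_probability.

Lemma integral_usphere_mulmx_le (h : 'cV[R]_n -> \bar R) (M : 'M[R]_n) :
  M \in unitmx -> measurable_fun setT h -> (forall x, 0 <= h x)%E -> homogeneous_inv h ->
  (`|\det M|%:E * \int[mu]_(u in usphere) h (M *m u) <= \int[mu]_(u in usphere) h u)%E.
Proof.
move=> uM mh h0 hh; set X := (X in (X <= _)%E); set Y := (X in (_ <= X)%E).
have Y0 : (0 <= Y)%E by apply: integral_ge0 => x _; exact: h0.
have XY t : 1 < t -> (X <= t%:E * Y)%E.
  move=> t1; have n0 : 0 < n%:R :> R by rewrite ltr0n (ltnW n2).
  (* With this [e] the error factor [expR e ^+ n] is exactly [t]. *)
  have e0 : 0 < ln t / n%:R by rewrite divr_gt0 // ln_gt0.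
  have := integral_usphere_mulmx_approx e0 uM mh h0 hh.
  by rewrite -expRM_natl mulrC divfK ?gt_eqF // lnK // posrE; apply: lt_trans t1.
move: Y0 XY; case: Y => [y|_ _|//]; last by rewrite leey.
rewrite lee_fin => y0 XY.
apply/lee_addgt0Pr => d d0.
(* The excess [d * y / (1 + y)] is at most [d]; the summand 1 covers [y = 0]. *)
have := XY (1 + d / (1 + y)); rewrite ltrDl divr_gt0 ?ltr_wpDr // => /(_ isT) /le_trans; apply.
rewrite -EFinM -EFinD lee_fin mulrDl mul1r lerD2l.
by rewrite mulrAC ler_pdivrMr ?ltr_wpDr // mulrDr mulr1 lerDr ltW.
Qed.

(** The reverse inequality is the same bound for [invmx M] and the function [h] composed with
    [M]. *)
Lemma integral_usphere_mulmx (h : 'cV[R]_n -> \bar R) (M : 'M[R]_n) :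
  M \in unitmx -> measurable_fun setT h -> (forall x, 0 <= h x)%E -> homogeneous_inv h ->
  (`|\det M|%:E * \int[mu]_(u in usphere) h (M *m u) = \int[mu]_(u in usphere) h u)%E.
Proof.
move=> uM mh h0 hh; apply/eqP; rewrite eq_le integral_usphere_mulmx_le //=.
have uM' : invmx M \in unitmx by rewrite unitmx_inv.
have mhM : measurable_fun setT (fun x => h (M *m x)).
  exact: (measurableT_comp mh (measurable_mulmx M)).
have := integral_usphere_mulmx_le uM' mhM (fun x => h0 _) (homogeneous_inv_mulmx M hh).
under eq_integral do rewrite mulKVmx //.
have dM : 0 < `|\det M| by rewrite normr_gt0 -unitfE -unitmxE.
rewrite det_inv normfV => /(lee_wpmul2l (ltW _)) => /(_ `|\det M|%:E).
by rewrite lte_fin => /(_ dM); rewrite muleA -EFinM mulfV ?gt_eqF // mul1e.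
Qed.

End sphere_integral.

(** * Smooth functions and linear maps *)

Section continuous_measurable.
Context {R : realType} {n : nat}.

(** An open set is the union of the countably many boxes with rational centre and rational half-side
    that it contains. *)
Lemma open_measurable_cV (U : set 'cV[R]_n) : open U -> measurable U.
Proof.
move=> oU.
pose B (z : {ffun 'I_n -> rat} * rat) : set 'cV[R]_n :=
  obox (\col_i (ratr (z.1 i) - ratr z.2)) (\col_i (ratr (z.1 i) + ratr z.2)).
pose F k : set 'cV[R]_n := if unpickle k is Some z then
  (if pselect (B z `<=` U) then B z else set0) else set0.
rewrite (_ : U = \bigcup_k F k).
  apply: bigcupT_measurable => k; rewrite /F.
  by case: unpickle => // z; case: pselect => [zU|zU] //=; exact: measurable_obox.
apply/seteqP; split => x; last first.
  by move=> [k _]; rewrite /F; case: unpickle => // z; case: pselect => [zU|//] /= /zU.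
move=> Ux; have /nbhs_ballP [e /= e0 eU] : nbhs x U by exact: open_nbhs_nbhs.
(* A box of half-side below [e / 2] containing [x] lies in the ball of radius [e] about [x]. *)
have e2 : 0 < e / 2 by rewrite divr_gt0.
have [r] := rat_in_itvoo e2; rewrite in_itv /= => /andP[r0 re].
have /choice[q qP] : forall i, exists q : rat, `|ratr q - x i ord0| < ratr r.
  move=> i.
  have : x i ord0 - ratr r < x i ord0 + ratr r by rewrite ltrD2l gt0_cp.
  move=> /rat_in_itvoo [q]; rewrite in_itv /= => /andP[h1 h2].
  by exists q; rewrite ltr_norml; apply/andP; split; lra.
pose z : {ffun 'I_n -> rat} * rat := ([ffun i => q i], r).
have zU : B z `<=` U.
  move=> y yB; apply: eU; split=> // i j; rewrite ord1; have := yB i; have := qP i.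
  rewrite /ball /= in_itv /= !mxE /= !ffunE ltr_norml => /andP[h1 h2] /andP[h3 h4].
  by rewrite ltr_norml; apply/andP; split; lra.
exists (pickle z) => //; rewrite /F pickleK; case: pselect => //= zU' i.
have := qP i; rewrite /= in_itv /= !mxE /= !ffunE ltr_norml => /andP[h1 h2].
by apply/andP; split; lra.
Qed.

Lemma continuous_measurable_fun_cV (f : 'cV[R]_n -> R) :
  continuous f -> measurable_fun setT (f : 'cV[R]_n -> measurableTypeR R).
Proof.
move=> /continuousP cf; apply: (measurability _ (RGenOpens.measurableE R)).
move=> _ [_ [a [b ->] <-]]; rewrite setTI; apply: open_measurable_cV.
by apply: cf; exact: interval_open.
Qed.

End continuous_measurable.

(** * Directional derivatives *)

Section directional_derivatives.
Context {R : realType} {V : normedModType R}.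
Implicit Types (f : V -> R) (x v w : V).

(** The one-variable mean value theorem on the segment from 0 to [h], with [h] of either sign. *)
Lemma mean_value_direction f v x (h : R) : (forall y, derivable f y v) ->
  exists2 c, `|c| <= `|h| & f (h *: v + x) - f x = h * 'D_v f (c *: v + x).
Proof.
move=> df; pose g (t : R) := f (t *: v + x).
have dg (t : R) : is_derive t (1 : R) g ('D_v f (t *: v + x)).
  have e : (fun k : R => k^-1 *: (g (k *: (1 : R) + t) - g t)) =
    (fun k => k^-1 *: (f (k *: v + (t *: v + x)) - f (t *: v + x))).
    apply/funext => k; rewrite /g; congr (_ *: (f _ - _)).
    by rewrite [k *: 1]mulr1 scalerDl addrA.
  apply: DeriveDef; first by rewrite /derivable e; exact: df.
  by rewrite /derive e.
have cg (A : set R) : {within A, continuous g}.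
  apply: continuous_subspaceT => t; apply: differentiable_continuous.
  by apply/derivable1_diffP; case: (dg t).
have [h0|h0] := leP 0 h.
  have [c] := MVT_segment h0 (fun t _ => dg t) (cg _).
  rewrite in_itv /= => /andP[c0 ch] e; exists c; first by rewrite !ger0_norm.
  by move: e; rewrite /g scale0r add0r subr0 mulrC.
have [c] := MVT_segment (ltW h0) (fun t _ => dg t) (cg _).
rewrite in_itv /= => /andP[ch c0] e; exists c.
  by rewrite !ler0_norm // ?lerN2 // ltW.
by move: e; rewrite /g scale0r add0r sub0r mulrN => e; rewrite -opprB e opprK mulrC.
Qed.

(** The increment is split into a step along [w] followed by one along [v]. The mean value theorem
    and the continuity of ['D_v f] control the second, so directions can be added one at a time. *)
Lemma is_derive_addZ f x v w (a dw : R) : (forall y, derivable f y v) ->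
  continuous ('D_v f) -> is_derive x w f dw ->
  is_derive x (a *: v + w) f (a * 'D_v f x + dw).
Proof.
move=> dv cv [dfw <-].
suff h : (fun h : R => h^-1 *: (f (h *: (a *: v + w) + x) - f x)) @ 0^' --> a * 'D_v f x + 'D_w f x.
  by apply: DeriveDef; [apply/cvg_ex; eexists; exact: h|exact: cvg_lim h].
pose g (h : R) := h^-1 *: (f ((h * a) *: v + (h *: w + x)) - f (h *: w + x)).
rewrite (_ : (fun _ => _) = (fun h => g h + h^-1 *: (f (h *: w + x) - f x))); last first.
  apply/funext => h; rewrite /g -scalerDr addrA subrK; congr (_ *: (f _ - _)).
  by rewrite scalerDr scalerA addrA.
apply: cvgD; last exact: dfw.
apply/cvgrPdist_lt => e e0.
have a0 : 0 < `|a| + 1 by rewrite ltr_wpDl.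
have /cvgrPdist_lt /(_ (e / (`|a| + 1))) := cv x.
rewrite divr_gt0 // => /(_ isT) /nbhs_ballP [d /= d0 hd].
(* The displacement of the intermediate point from [x] is at most [|h| * r]; the summand 1 keeps [r]
   positive. *)
pose r := `|a| * `|v| + `|w| + 1.
have r0 : 0 < r by rewrite ltr_wpDl // addr_ge0 // mulr_ge0.
near=> h.
have h0 : h != 0 by near: h; exact: nbhs_dnbhs_neq.
have hr : `|h| < d / r.
  near: h; apply: cvg_within; apply/nbhs_ballP; exists (d / r); first by rewrite /= divr_gt0.
  by move=> y; rewrite /ball /= sub0r normrN.
rewrite /g; have [c ch ->] := mean_value_direction (h *: w + x) (h * a) dv.
rewrite /GRing.scale /= mulrA mulrA mulVf // mul1r -mulrBr normrM.
set D := `|_ - _|.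
have DE : D < e / (`|a| + 1).
  apply: hd; rewrite -ball_normE /ball_ /= addrA opprD addrCA subrr addr0 normrN.
  apply: le_lt_trans (ler_normD _ _) _; rewrite !normrZ.
  apply: (@le_lt_trans _ _ (`|h| * r)); last by rewrite -ltr_pdivlMr.
  rewrite /r mulrDr mulr1 mulrDr mulrA -normrM.
  apply: ler_wpDr => //; rewrite lerD2r; exact: ler_wpM2r.
apply: (@le_lt_trans _ _ ((`|a| + 1) * D)).
  by apply: ler_wpM2r; rewrite ?normr_ge0 // lerDl.
by rewrite mulrC -ltr_pdivlMr.
Unshelve. all: by end_near.
Qed.

End directional_derivatives.

Lemma continuous_lincomb (R : realType) (T : topologicalType) (f g : T -> R) (c : R) :
  continuous f -> continuous g -> continuous (fun t => c * f t + g t).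
Proof. by move=> cf cg t; apply: cvgD; [apply: cvgMr; exact: cf|exact: cg]. Qed.

Section smooth_linear.
Context {R : realType} {n : nat}.
Implicit Types (f g : 'cV[R]_n -> R) (M : 'M[R]_n) (x v : 'cV[R]_n) (s : seq 'I_n).

Lemma smooth_continuous f : smooth f -> continuous f.
Proof. by move=> /(_ [::]) []. Qed.

Lemma smooth_derivable f i x : smooth f -> derivable f x (delta_mx i ord0).
Proof. by move=> /(_ [::]) []. Qed.

Lemma smooth_partial f i : smooth f -> smooth (partial i f).
Proof. by move=> sf s; have := sf (rcons s i); rewrite /= foldr_rcons. Qed.

Lemma partialD f g c i : smooth f -> smooth g ->
  partial i (fun x => c * f x + g x) = (fun x => c * partial i f x + partial i g x).
Proof.
move=> sf sg; apply/funext => x.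
have df := @smooth_derivable _ i x sf; have dg := @smooth_derivable _ i x sg.
have := deriveD (derivableZ (k := c) df) dg.
by rewrite deriveZ.
Qed.

Lemma smoothD f g c : smooth f -> smooth g -> smooth (fun x => c * f x + g x).
Proof.
move=> sf sg s.
have -> : foldr partial (fun x => c * f x + g x) s =
    (fun x => c * foldr partial f s x + foldr partial g s x).
  elim: s => [//|i s /= ->]; apply: partialD.
    by move=> t; have := sf (t ++ s); rewrite foldr_cat.
  by move=> t; have := sg (t ++ s); rewrite foldr_cat.
have [cf df] := sf s; have [cg dg] := sg s; split.
  exact: continuous_lincomb.
by move=> i x; apply: derivableD => //; apply: (derivableZ (k := c)); exact: df.
Qed.

Lemma smooth0 : smooth (fun _ : 'cV[R]_n => 0 : R).
Proof.
move=> s; have -> : foldr partial (fun _ : 'cV[R]_n => 0 : R) s = (fun=> 0).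
  by elim: s => [//|i s /= ->]; apply/funext => x; exact: derive_cst.
by split; [exact: cst_continuous|move=> i x; exact: derivable_cst].
Qed.

Lemma smooth_sum (I : Type) (r : seq I) (c : I -> R) (f : I -> 'cV[R]_n -> R) :
  (forall i, smooth (f i)) -> smooth (fun x => \sum_(i <- r) c i * f i x).
Proof.
move=> sf; elim: r => [|i r IH].
  rewrite (_ : (fun _ => _) = fun=> 0); first exact: smooth0.
  by apply/funext => x; rewrite big_nil.
rewrite (_ : (fun _ => _) = fun x => c i * f i x + \sum_(j <- r) c j * f j x).
  exact: smoothD.
by apply/funext => x; rewrite big_cons.
Qed.

(** [v] is expanded in the standard basis and its components are added one by one, each having a
    continuous partial derivative. *)
Lemma smooth_is_derive f x v : smooth f -> is_derive x v f (dotcv v (grad f x)).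
Proof.
move=> sf.
have -> : v = \sum_i v i ord0 *: delta_mx i ord0.
  rewrite [LHS]matrix_sum_delta; apply: eq_bigr => i _.
  by rewrite big_ord_recl big_ord0 addr0.
have -> : dotcv (\sum_i v i ord0 *: delta_mx i ord0) (grad f x) = \sum_i v i ord0 * partial i f x.
  apply: eq_bigr => i _; rewrite [grad f x _ _]mxE; congr (_ * _).
  rewrite summxE (bigD1 i) //= !mxE !eqxx mulr1 big1 ?addr0 // => j ji.
  by rewrite !mxE eq_sym (negbTE ji) mulr0.
elim: (index_enum _) => [|i r IH].
  rewrite !big_nil.
  have e : (fun h : R => h^-1 *: (f (h *: (0 : 'cV[R]_n) + x) - f x)) = (fun=> 0).
    by apply/funext => h; rewrite scaler0 add0r subrr scaler0.
  apply: DeriveDef; first by rewrite /derivable e; exact: is_cvg_cst.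
  by rewrite /derive e; apply: cvg_lim => //; exact: cvg_cst.
rewrite !big_cons; apply: is_derive_addZ => //.
  by move=> y; exact: smooth_derivable.
exact: smooth_continuous (smooth_partial i sf).
Qed.

Lemma is_derive_mulmx f M x v : smooth f ->
  is_derive x v (fun y => f (M *m y)) (dotcv (M *m v) (grad f (M *m x))).
Proof.
move=> sf; have [df <-] := smooth_is_derive (M *m x) (M *m v) sf.
have e : (fun h : R => h^-1 *: (f (M *m (h *: v + x)) - f (M *m x))) =
    (fun h : R => h^-1 *: (f (h *: (M *m v) + M *m x) - f (M *m x))).
  by apply/funext => h; rewrite mulmxDr scalemxAr.
by apply: DeriveDef; rewrite /derivable /derive e.
Qed.

(** The result is again a function composed with [M], the form that an induction over iterated
    partial derivatives requires. *)
Lemma partial_mulmx f M i : smooth f ->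
  partial i (fun y => f (M *m y)) = (fun x => (fun y => \sum_j M j i * partial j f y) (M *m x)).
Proof.
move=> sf; apply/funext => x; rewrite /partial.
have [_ ->] := is_derive_mulmx M x (delta_mx i ord0) sf.
apply: eq_bigr => j _; rewrite [grad _ _ _ _]mxE; congr (_ * _).
by rewrite -colE mxE.
Qed.

Lemma grad_mulmx f M x : smooth f ->
  grad (fun y => f (M *m y)) x = M^T *m grad f (M *m x).
Proof.
move=> sf; apply/matrixP => i j; rewrite mxE partial_mulmx // mxE.
by apply: eq_bigr => k _; rewrite !mxE.
Qed.

Lemma continuous_mulmx (T : topologicalType) (g : T -> 'cV[R]_n) M :
  continuous g -> continuous (fun t => M *m g t).
Proof.
move=> cg t; apply/cvg_ballP => e e0.
have H i : \forall y \near t, ball ((M *m g t) i ord0) e ((M *m g y) i ord0).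
  have : continuous (fun y : T => \sum_j M i j * g y j ord0).
    apply: continuous_sumr => j y; apply: cvgMr.
    exact: (cvg_comp _ _ (cg y) (@coord_continuous R n 1 j ord0 (g y))).
  move=> /(_ t) /cvg_ballP /(_ e e0); apply: filterS => y.
  by rewrite !mxE.
have FF : Filter (nbhs t) := nbhs_filter t.
apply: (@filterS _ _ FF _ _ _ (filter_forall FF H)) => y hy; split => // i j.
by rewrite ord1; exact: hy.
Qed.

Lemma mulmx_continuous M : continuous (mulmx M : 'cV[R]_n -> 'cV[R]_n).
Proof. exact: (continuous_mulmx (g := id) (fun x => cvg_id)). Qed.

Lemma smooth_mulmx f M : smooth f -> smooth (fun x => f (M *m x)).
Proof.
move=> sf s.
have [g sg ->] : exists2 g, smooth g & foldr partial (fun x => f (M *m x)) s = (fun x => g (M *m x)).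
  elim: s => [|i s [g sg /= ->]]; first by exists f.
  eexists; last exact: partial_mulmx.
  by apply: smooth_sum => j; exact: smooth_partial.
split.
  move=> x; apply: (@continuous_comp _ _ _ (mulmx M) g x); first exact: mulmx_continuous.
  exact: smooth_continuous.
by move=> i x; case: (is_derive_mulmx M x (delta_mx i ord0) sg).
Qed.

(** The support of the composite lies in the image of the compact support of [f] under [invmx M]. *)
Lemma Ccoo_mulmx f M : M \in unitmx -> Ccoo f -> Ccoo (fun x => f (M *m x)).
Proof.
move=> uM [sf cf]; split; first exact: smooth_mulmx.
have cK : compact (mulmx (invmx M) @` closure [set x | f x != 0]).
  apply: continuous_compact => //; apply: continuous_subspaceT; exact: mulmx_continuous.
apply: (subclosed_compact _ cK); first exact: closed_closure.
have clK := compact_closed (@norm_hausdorff _ _) cK.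
rewrite [X in _ `<=` X](closure_id _).1 //; apply: closure_subset => x /= fx.
exists (M *m x); last by rewrite mulKmx.
exact: subset_closure.
Qed.

End smooth_linear.

(** * The capacity *)

Section inverses.
Context {R : realType}.

Lemma inve_EFinM (c : R) (x : \bar R) : 0 < c -> ((c%:E * x)^-1 = c^-1%:E * x^-1)%E.
Proof.
move=> c0; rewrite inveM; last by case: x => //= r; rewrite gt_eqF //= ltW // implybT.
by rewrite inver gt_eqF.
Qed.

Lemma measurable_inve d (T : measurableType d) (g : T -> \bar R) :
  measurable_fun setT g -> (forall t, 0 <= g t)%E ->
  measurable_fun setT (fun t => (g t)^-1)%E.
Proof.
move=> mg g0.
(* At [+oo], [fine] returns 0, whose power of exponent -1 is 0, the correct inverse. *)
rewrite (_ : (fun _ => _) = fun t => if g t == 0%E then +oo%E else (fine (g t) `^ (-1))%:E).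
  apply: measurable_fun_ifT => //.
    apply: (measurable_fun_bool true).
    rewrite (_ : _ @^-1` _ = g @^-1` [set 0%E]); last first.
      by apply/seteqP; split => t /eqP.
    by apply: mg => //; exact: emeasurable_set1.
  apply/measurable_EFinP; apply: (measurableT_comp (measurable_powR _)).
  by apply: (measurableT_comp _ mg); exact: fine_measurable.
apply/funext => t; case: (g t) (g0 t) => [r|_|//].
  by rewrite lee_fin inver eqe => r0; case: eqP => //= _; rewrite powR_inv1.
by rewrite /= powR_inv1 // invr0.
Qed.

End inverses.

Section capacity_transformation.
Context {R : realType} {n : nat}.
Implicit Types (f : 'cV[R]_n -> R) (x u : 'cV[R]_n) (M T : 'M[R]_n) (K : set 'cV[R]_n).
Variables (p tau : R).
Hypothesis p0 : 0 < p.

Lemma phi_ge0 t : 0 <= phi p tau t.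
Proof. by rewrite addr_ge0 // mulr_ge0 ?powR_ge0 // le_max lexx orbT. Qed.

Lemma phiZ s t : 0 <= s -> phi p tau (s * t) = s * phi p tau t.
Proof.
move=> s0; have e y : Num.max (s * y) 0 = s * Num.max y 0 by rewrite maxr_pMr // mulr0.
by rewrite /phi -mulrN !e; ring.
Qed.

Lemma measurable_phi : measurable_fun setT (phi p tau).
Proof.
by apply: measurable_funD; apply: measurable_funM => //; apply: measurable_maxr.
Qed.

Definition energy f u : \bar R :=
  (\int[lebesgue_cV n]_x (phi p tau (dotcv u (grad f x)) `^ p)%:E)%E.

Lemma energy_ge0 f u : (0 <= energy f u)%E.
Proof. by apply: integral_ge0 => x _; rewrite lee_fin powR_ge0. Qed.

Lemma measurable_grad f : smooth f -> measurable_fun setT (grad f).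
Proof.
move=> sf; apply: measurable_fun_cV => i.
rewrite (_ : (fun _ => _) = partial i f); last by apply/funext => x; rewrite mxE.
exact: continuous_measurable_fun_cV (smooth_continuous (smooth_partial i sf)).
Qed.

Lemma measurable_energy_density dX (X : measurableType dX) (a b : X -> 'cV[R]_n) :
  measurable_fun setT a -> measurable_fun setT b ->
  measurable_fun setT (fun t => (phi p tau (dotcv (a t) (b t)) `^ p)%:E).
Proof.
move=> ma mb; apply/measurable_EFinP; apply: (measurableT_comp (measurable_powR _)).
by apply: (measurableT_comp measurable_phi); exact: measurable_dotcv.
Qed.

Lemma measurable_energy f : smooth f -> measurable_fun setT (energy f).
Proof.
move=> sf.
pose F (z : 'cV[R]_n * 'cV[R]_n) := (phi p tau (dotcv z.1 (grad f z.2)) `^ p)%:E.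
apply: (@measurable_fun_fubini_tonelli_F _ _ _ _ _ (lebesgue_cV n) F).
  apply: measurable_energy_density => //.
  exact: (measurableT_comp (measurable_grad sf) measurable_snd).
by move=> z; rewrite lee_fin powR_ge0.
Qed.

Lemma energyZ f s u : smooth f -> 0 < s -> energy f (s *: u) = ((s `^ p)%:E * energy f u)%E.
Proof.
move=> sf s0; rewrite /energy -ge0_integralZl_EFin ?powR_ge0 //.
- apply: eq_integral => x _; rewrite -EFinM; congr (_%:E).
  by rewrite dotcvZl phiZ ?ltW // powRM ?phi_ge0 // ltW.
- by move=> x _; rewrite lee_fin powR_ge0.
- by apply: measurable_energy_density => //; exact: measurable_grad.
Qed.

(** The chain rule puts [M^T] on the gradient, which moves to [M] on [u] in the scalar product; the
    substitution by [M] gives the determinant. *)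
Lemma energy_mulmx f M u : M \in unitmx -> smooth f ->
  energy (fun x => f (M *m x)) u = (`|\det M|^-1%:E * energy f (M *m u))%E.
Proof.
move=> uM sf.
have dM : 0 < `|\det M| by rewrite normr_gt0 -unitfE -unitmxE.
have mg : measurable_fun setT (fun x => (phi p tau (dotcv (M *m u) (grad f x)) `^ p)%:E).
  by apply: measurable_energy_density => //; exact: measurable_grad.
have g0 x : setT x -> (0 <= (phi p tau (dotcv (M *m u) (grad f x)) `^ p)%:E)%E.
  by move=> _; rewrite lee_fin powR_ge0.
rewrite /energy [X in _ = (_ * X)%E](lebesgue_scales_integral (lebesgue_scales_unitmx uM) measurableT mg g0).
rewrite muleA -EFinM mulVf ?gt_eqF // mul1e preimage_setT.
apply: eq_integral => x _; rewrite grad_mulmx //; congr ((phi _ _ _ `^ _)%:E).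
by rewrite !dotcvE trmx_mul mulmxA.
Qed.

(** The integrand of [Haff], of degree [-n] in [u] because [energy] has degree [p]. *)
Definition polar_density f u : \bar R := ((energy f u `^ (n%:R / p))^-1)%E.

Lemma polar_density_ge0 f u : (0 <= polar_density f u)%E.
Proof. by rewrite inve_ge0 poweR_ge0. Qed.

Lemma measurable_polar_density f : smooth f -> measurable_fun setT (polar_density f).
Proof.
move=> sf; apply: measurable_inve; last by move=> u; exact: poweR_ge0.
exact: (measurableT_comp (measurable_poweR _) (measurable_energy sf)).
Qed.

Lemma homogeneous_polar_density f : smooth f -> homogeneous_inv (polar_density f).
Proof.
move=> sf s u s0; rewrite /polar_density energyZ // poweRM ?energy_ge0 ?lee_fin ?powR_ge0 //.
rewrite poweR_EFin -powRrM mulrCA divff ?gt_eqF // mulr1 powR_mulrn ?ltW //.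
by rewrite inve_EFinM // exprn_gt0.
Qed.

Lemma polar_density_mulmx f M u : M \in unitmx -> smooth f ->
  polar_density (fun x => f (M *m x)) u =
    ((`|\det M| `^ (n%:R / p))%:E * polar_density f (M *m u))%E.
Proof.
move=> uM sf; have dM : 0 < `|\det M| by rewrite normr_gt0 -unitfE -unitmxE.
rewrite /polar_density energy_mulmx // poweRM ?energy_ge0 ?lee_fin ?invr_ge0 //.
rewrite poweR_EFin inve_EFinM ?powR_gt0 ?invr_gt0 //; congr (_%:E * _)%E.
by rewrite -[`|_|^-1]powR_inv1 // -powRrM mulN1r powRN invrK.
Qed.

Variable mu : probability 'cV[R]_n R.
Hypotheses (n2 : (2 <= n)%N) (hmu : is_sphere_measure mu).

(** The density contributes [|\det M|] to the power [n / p] and the sphere identity one factor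
    [|\det M|^-1]; raising to the power [p / n] and inverting gives the exponent [- (n - p) / n]. *)
Lemma Haff_mulmx f M : M \in unitmx -> smooth f ->
  Haff mu p tau (fun x => f (M *m x)) =
    ((`|\det M|^-1 `^ ((n%:R - p) / n%:R))%:E * Haff mu p tau f)%E.
Proof.
move=> uM sf; have dM : 0 < `|\det M| by rewrite normr_gt0 -unitfE -unitmxE.
have n_gt0 : 0 < n%:R :> R by rewrite ltr0n (ltnW n2).
have mS : measurable (@usphere R n) := measurable_usphere.
have mF := measurable_polar_density sf.
have mFM : measurable_fun setT (fun u => polar_density f (M *m u)).
  exact: (measurableT_comp mF (measurable_mulmx M)).
have J0 : (0 <= \int[mu]_(u in usphere) polar_density f u)%E.
  by apply: integral_ge0 => u _; exact: polar_density_ge0.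
have E : (\int[mu]_(u in usphere) polar_density (fun x => f (M *m x)) u =
   (`|\det M| `^ (n%:R / p - 1))%:E * \int[mu]_(u in usphere) polar_density f u)%E.
  transitivity (\int[mu]_(u in usphere) ((`|\det M| `^ (n%:R / p))%:E * polar_density f (M *m u)))%E.
    by apply: eq_integral => u _; exact: polar_density_mulmx.
  have mSFM := measurable_funTS mFM.
  have F0 u : usphere u -> (0 <= polar_density f (M *m u))%E by move=> _; exact: polar_density_ge0.
  rewrite [LHS](ge0_integralZl_EFin mu mS F0 (mSFM _) (powR_ge0 _ _)).
  rewrite -[in RHS](integral_usphere_mulmx n2 hmu uM mF (polar_density_ge0 f) (homogeneous_polar_density sf)).
  rewrite muleA -EFinM; congr (_%:E * _)%E.
  (* One factor [|\det M|] is split off for the sphere identity. *)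
  by rewrite -[X in _ = _ * X](powRr1 (ltW dM)) -powRD ?subrK // (gt_eqF dM) implybT.
transitivity (((\int[mu]_(u in usphere) polar_density (fun x => f (M *m x)) u) `^ (p / n%:R))^-1)%E.
  by [].
rewrite E poweRM ?lee_fin ?powR_ge0 // poweR_EFin inve_EFinM ?powR_gt0 //.
congr (_%:E * _)%E; rewrite -(powR_inv1 (ltW dM)) -!powRrM -powRN; congr (_ `^ _).
by field; rewrite !gt_eqF.
Qed.

(** Composition with [T] and with [invmx T] matches the admissible functions of the image of [K]
    with those of [K], scaling [Haff] by a constant that passes through the infimum. *)
Lemma affine_capacity_mulmx T K : T \in unitmx ->
  affine_capacity mu p tau [set T *m x | x in K] =
    ((`|\det T| `^ ((n%:R - p) / n%:R))%:E * affine_capacity mu p tau K)%E.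
Proof.
move=> uT; have dT : 0 < `|\det T| by rewrite normr_gt0 -unitfE -unitmxE.
have uV : invmx T \in unitmx by rewrite unitmx_inv.
rewrite /affine_capacity -ereal_inf_pZl ?powR_gt0 //; congr ereal_inf.
apply/seteqP; split => [_ [g [Cg gK] <-]|_ [_ [f [Cf fK] <-] <-]].
  exists (Haff mu p tau (fun x => g (T *m x))).
    exists (fun x => g (T *m x)) => //; split; first exact: Ccoo_mulmx.
    by move=> x Kx; apply: gK; exists x.
  rewrite Haff_mulmx //; last by case: Cg.
  rewrite muleA -EFinM -powRM ?invr_ge0 // mulfV ?gt_eqF // powR1 mul1e //.
exists (fun x => f (invmx T *m x)).
  split; first exact: Ccoo_mulmx.
  by move=> _ [x Kx <-]; rewrite mulKmx //; exact: fK.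
by rewrite Haff_mulmx //; [rewrite det_inv normfV invrK|case: Cf].
Qed.

End capacity_transformation.

Theorem theorem4p1 (R : realType) (n : nat) (hn : (2 <= n)%N)
    (p : R) (hp1 : 1 <= p) (hpn : p < n%:R)
    (tau : R) (htau1 : -1 <= tau) (htau2 : tau <= 1)
    (mu : probability 'cV[R]_n R) (hmu : is_sphere_measure mu) :
  (forall (T : 'M[R]_n) (K : set 'cV[R]_n), T \in unitmx -> compact K ->
     affine_capacity mu p tau [set T *m x | x in K] =
       ((`|\det T| `^ ((n%:R - p) / n%:R))%:E * affine_capacity mu p tau K)%E)
  /\
  (forall (T : 'M[R]_n) (K : set 'cV[R]_n), T \in unitmx -> `|\det T| = 1 ->
     compact K ->
     affine_capacity mu p tau [set T *m x | x in K] = affine_capacity mu p tau K)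
  /\
  (forall (lambda : R) (K : set 'cV[R]_n), 0 < lambda -> compact K ->
     affine_capacity mu p tau [set lambda *: x | x in K] =
       ((lambda `^ (n%:R - p))%:E * affine_capacity mu p tau K)%E).
Proof.
have p0 : 0 < p := lt_le_trans ltr01 hp1.
have n0 : 0 < n%:R :> R by rewrite ltr0n (ltnW hn).
split=> [T K uT _|]; first exact: affine_capacity_mulmx.
split=> [T K uT dT _|l K l0 _].
  by rewrite affine_capacity_mulmx // dT powR1 mul1e.
(* The dilation is the scalar matrix [l%:M] with determinant [l ^+ n], and [n * ((n - p) / n)] is
   [n - p]. *)
have -> : [set l *: x | x in K] = [set l%:M *m x | x in K].
  by apply: eq_imagel => x _; rewrite mul_scalar_mx.
rewrite affine_capacity_mulmx //; last first.
  by rewrite unitmxE det_scalar unitfE expf_neq0 // gt_eqF.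
rewrite det_scalar ger0_norm ?exprn_ge0 ?ltW // -powR_mulrn ?ltW // -powRrM.
by rewrite mulrC divfK // gt_eqF.
Qed.
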